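(* There exist absolute constants $0<c\le C<\infty$ such that for all positive integers $k,s$ and every symmetric gauge function $\tau$ on $\mathbb{R}^{k\wedge s}$, with associated unitarily invariant norm $\|\cdot\|_\tau$ on $\mathbb{R}^{k\times s}$, the following holds. Suppose one observes $Y=M+Z$ with $M\in\mathbb{R}^{k\times s}$ unknown and $Z\in\mathbb{R}^{k\times s}$ having i.i.d. $N(0,1)$ entries. Then $$c\,(k\vee s)\,\tau^2(\mathbf 1)\ \le\ \inf_{\widetilde M}\ \sup_{M\in\mathbb{R}^{k\times s}}\mathbb{E}\|\widetilde M-M\|_\tau^2\ \le\ C\,(k\vee s)\,\tau^2(\mathbf 1),$$ where the infimum is over all estimators $\widetilde M=\widetilde M(Y)$ and $\mathbf 1$ is the all-one vector in $\mathbb{R}^{k\wedge s}$.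
   Context: $a\vee b=\max\{a,b\}$, $a\wedge b=\min\{a,b\}$. A symmetric gauge function on $\mathbb{R}^d$ is a norm on $\mathbb{R}^d$ invariant under permutations and sign changes of the coordinates. For a symmetric gauge function $\tau$ on $\mathbb{R}^{k\wedge s}$, $\|A\|_\tau=\tau(\sigma(A))$ for $A\in\mathbb{R}^{k\times s}$, where $\sigma(A)\in\mathbb{R}^{k\wedge s}$ is the vector of ordered singular values of $A$; every unitarily invariant norm on $\mathbb{R}^{k\times s}$ is of this form. An estimator is a measurable function of the observation. *)

(* Defs.v *)
From HB Require Import structures.
From mathcomp Require Import all_boot all_order all_algebra all_fingroup.
From mathcomp Require Import spectral complex.
From mathcomp Require Import all_classical all_reals all_analysis.

Set Implicit Arguments.
Unset Strict Implicit.
Unset Printing Implicit Defensive.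

Import Order.TTheory GRing.Theory Num.Theory numFieldNormedType.Exports.

Local Open Scope classical_set_scope.
Local Open Scope ring_scope.

(* Nonnegativity of tau, and tau 0 = 0, follow from the first two fields. *)
Record symmetric_gauge (R : realType) (n : nat) (tau : 'rV[R]_n -> R) : Prop :=
  SymmetricGauge {
    gauge_triangle : forall x y, tau (x + y) <= tau x + tau y;
    gauge_homogeneous : forall a x, tau (a *: x) = `|a| * tau x;
    gauge_definite : forall x, tau x = 0 -> x = 0;
    gauge_perm : forall (p : 'S_n) x, tau (col_perm p x) = tau x;
    gauge_sign : forall (e : 'I_n -> bool) (x : 'rV[R]_n),
      tau (\row_i ((-1) ^+ e i * x 0 i)) = tau x }.

(* The singular values of A are the square roots of the eigenvalues, with
   multiplicity, of the positive semidefinite matrix A^T A, in nonincreasing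
   order; only the first minn k s of these s numbers can be nonzero.
   [spectral_diag] lists the eigenvalues of a normal matrix over an
   algebraically closed field, hence the detour through R[i]; the eigenvalues
   in question are real and nonnegative. *)
Definition singular_values (R : realType) (k s : nat) (A : 'M[R]_(k, s)) :
    'rV[R]_(minn k s) :=
  let ev := spectral_diag (map_mx (real_complex R) (A^T *m A)) in
  let sv := sort >=%R [seq Num.sqrt (complex.Re (ev 0 j)) | j <- enum 'I_s] in
  \row_i sv`_i.

Definition ui_norm (R : realType) (k s : nat) (tau : 'rV[R]_(minn k s) -> R)
    (A : 'M[R]_(k, s)) : R :=
  tau (singular_values A).

Definition borel_matrix (R : realType) (k s : nat) :=
  g_sigma_algebraType (@open 'M[R]_(k, s)).

Definition estimator (R : realType) (k s : nat)
    (f : 'M[R]_(k, s) -> 'M[R]_(k, s)) : Prop :=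
  measurable_fun setT (f : borel_matrix R k s -> borel_matrix R k s).

Definition mutually_independent d (T : measurableType d) (R : realType)
    (P : probability T R) (I : finType) (X : I -> {RV P >-> R}) : Prop :=
  forall (J : {set I}) (B : I -> set R),
    (forall i, i \in J -> measurable (B i)) ->
    (P (\bigcap_(i in [set i | i \in J]) (X i @^-1` B i)) =
     \prod_(i in J) P (X i @^-1` B i))%E.

Definition iid_standard_normal d (T : measurableType d) (R : realType)
    (P : probability T R) (I : finType) (X : I -> {RV P >-> R}) : Prop :=
  mutually_independent X /\
  forall i (B : set R), measurable B ->
    distribution P (X i) B = normal_prob (0 : R) 1 B.

Definition noise_matrix d (T : measurableType d) (R : realType)
    (P : probability T R) (k s : nat) (Z : 'I_k * 'I_s -> {RV P >-> R}) (w : T)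
    : 'M[R]_(k, s) :=
  \matrix_(i, j) Z (i, j) w.

Definition risk d (T : measurableType d) (R : realType)
    (P : probability T R) (k s : nat) (Z : 'I_k * 'I_s -> {RV P >-> R})
    (tau : 'rV[R]_(minn k s) -> R) (f : 'M[R]_(k, s) -> 'M[R]_(k, s))
    (M : 'M[R]_(k, s)) : \bar R :=
  'E_P[fun w => ui_norm tau (f (M + noise_matrix Z w) - M) ^+ 2].

Definition minimax_risk d (T : measurableType d) (R : realType)
    (P : probability T R) (k s : nat) (Z : 'I_k * 'I_s -> {RV P >-> R})
    (tau : 'rV[R]_(minn k s) -> R) : \bar R :=
  ereal_inf [set ereal_sup [set risk Z tau f M | M in setT]
            | f in @estimator R k s].

(* Main.v *)
Require Import Defs.
From HB Require Import structures.
From mathcomp Require Import all_boot all_order all_algebra all_fingroup.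
From mathcomp Require Import spectral complex.
From mathcomp Require Import all_classical all_reals all_analysis.
From mathcomp Require Import measurable_realfun normal_distribution.
From mathcomp Require Import ring lra.

(** Write m = minn k s and n = maxn k s; both bounds compare the norm with
    tau(1) times a norm that no longer depends on tau.

    Upper bound.  The estimator Y |-> Y has risk E ||Z||_tau^2 for every M, and
    ||Z||_tau is at most tau(1) times the operator norm of Z, because tau is
    monotone in the absolute values of the coordinates (gauge_le_sup).  The
    operator norm is at most twice the maximum of x Z y^T over two nets of the
    unit balls (net_operator_bound).  The nets consist of scaled integer points,
    so that rounding towards 0 produces an approximation inside the ball and a
    Gaussian sum over the integers bounds the cardinal by exp(18 p) in dimension
    p (net_size).  The moment generating function of x Z y^T then gives
    E ||Z||_op^2 = O(n) through a union bound (minimax_upper_bound).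

    Lower bound.  Averaging over permutations gives tau(x) >= tau(1) mean(x)
    (gauge_mean), so the loss is at least tau(1)/m times the nuclear norm, which
    in turn dominates tr(A B^T) for each contraction B (nuclear_duality).  Put
    the uniform prior on the sign matrices e in {-1,1}^(k x s).  Given Y, let e
    and e' be two independent draws from the posterior.  By the triangle
    inequality, no value f(Y) is close to both, so the Bayes risk is at least a
    constant times the mean squared norm of e - e' (sum_pairs_le).  The
    posterior is a product over the entries, and after integration over Y the
    entries of e - e' are independent, centered, bounded, and nonzero with a
    probability that is an absolute constant (sign_coupling_gt0).  For
    D = e - e' and the scale t = K sqrt n one has
    ||D||_* >= 2 t (tr H - tr H^2) with H = D^T D / t^2: the right-hand side is
    at most the pairing of D with the contraction 2 X (1 + X^T X)^-1, where
    X = D / t (dual_certificate).  Only the second and fourth moments of the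
    entries of D enter, and they give a mean nuclear norm of order m sqrt n
    (expected_dual_gap), hence a risk of order tau(1)^2 n (minimax_lower_bound).

    Measurability enters through linear forms of f(Y) - M only: the loss is
    bounded from below by a maximum of finitely many of them (dual_seminorm) and
    from above in terms of a sum of their exponentials, and integrals of
    nonnegative functions are monotone (ge0_le_integral_nonmeasurable). *)

Set Implicit Arguments.
Unset Strict Implicit.
Unset Printing Implicit Defensive.

Import Order.TTheory GRing.Theory Num.Theory numFieldNormedType.Exports.
Local Open Scope classical_set_scope.
Local Open Scope ring_scope.

(** * Integrals of products of independent variables *)

Lemma integral_indicM d (T : measurableType d) (R : realType)
    (mu : {measure set T -> \bar R}) (B : set T) (H : T -> R) :
  (\int[mu]_x (\1_B x * H x)%:E = \int[mu]_(x in B) (H x)%:E)%E.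
Proof.
rewrite [RHS]integral_mkcond; apply: eq_integral => x _.
by rewrite patchE indicE; case: ifP => _; rewrite ?mul1r ?mul0r.
Qed.

Section density.
Local Open Scope ereal_scope.
Context d d' (T : measurableType d) (T' : measurableType d') (R : realType).
Variables (mu : {measure set T -> \bar R}) (nu : {measure set T' -> \bar R}).
Variables (X : T -> T') (H : T -> R) (c : R).
Hypotheses (mX : measurable_fun setT X) (mH : measurable_fun setT H).
Hypotheses (H0 : forall x, (0 <= H x)%R) (c0 : (0 <= c)%R).
Hypothesis XH : forall B, measurable B ->
  \int[mu]_x (\1_B (X x) * H x)%:E = nu B * c%:E.

Import HBNNSimple.

Let nnsfun_case (g : {nnsfun T' >-> R}) :
  \int[mu]_x (g (X x) * H x)%:E = (\int[nu]_y (g y)%:E) * c%:E.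
Proof.
have mp r : measurable (g @^-1` [set r]) by [].
have mXp r : measurable_fun setT (fun x => \1_(g @^-1` [set r]) (X x) : R).
  exact: measurableT_comp.
transitivity (\sum_(r \in range g)
    \int[mu]_x (r * (\1_(g @^-1` [set r]) (X x) * H x))%:E).
  rewrite -ge0_integral_fsum//.
  - apply: eq_integral => x _; rewrite fsumEFin// (fimfunE g) mulr_fsuml.
    by congr (_ %:E); apply: eq_fsbigr => r _; rewrite mulrA.
  - move=> r; apply/measurable_EFinP/measurable_funM => //.
    exact: measurable_funM.
  - move=> r x _; rewrite lee_fin mulrA mulr_ge0//.
    have := nnfun_muleindic_ge0 g r (X x); rewrite -EFinM lee_fin; exact.
rewrite integralT_nnsfun sintegralE ge0_mule_fsuml; last first.
  by move=> r; exact: nnsfun_mulemu_ge0.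
apply: eq_fsbigr => r /[!inE] -[y _ gy].
under eq_integral do rewrite EFinM.
have r0 : (0 <= r)%R by rewrite -gy.
rewrite ge0_integralZl//; last first.
- by move=> x _; rewrite lee_fin mulr_ge0.
- by apply/measurable_EFinP/measurable_funM.
by rewrite XH// muleA.
Qed.

(** Passing from indicators to nonnegative measurable functions, with a
    bystander density [H].  One case is the independence of [X] and [H]; with
    [X = id] and [c = 1] it says that a measure with density [H] integrates
    by multiplication with [H]. *)
Lemma ge0_integral_density (g : T' -> R) : measurable_fun setT g ->
  (forall y, (0 <= g y)%R) ->
  \int[mu]_x (g (X x) * H x)%:E = (\int[nu]_y (g y)%:E) * c%:E.
Proof.
move=> mg g0.
have mEg : measurable_fun setT (EFin \o g) by exact/measurable_EFinP.
pose g_ := nnsfun_approx measurableT mEg.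
have g_g y : (g_ n y)%:E @[n --> \oo] --> (g y)%:E.
  by apply: cvg_nnsfun_approx => // ? _; rewrite lee_fin.
have gnd y : {homo (fun n => g_ n y) : m n / (m <= n)%N >-> (m <= n)%R}.
  by move=> m n mn; exact/lefP/nd_nnsfun_approx.
transitivity (limn (fun n => \int[mu]_x (g_ n (X x) * H x)%:E)).
  rewrite -monotone_convergence//.
  - apply: eq_integral => x _; apply/esym/cvg_lim => //.
    under eq_fun do rewrite EFinM.
    by rewrite EFinM; exact: cvgeZr.
  - move=> n; apply/measurable_EFinP/measurable_funM => //.
    exact: measurableT_comp.
  - by move=> n x _; rewrite lee_fin mulr_ge0.
  - by move=> x _ m n mn; rewrite lee_fin ler_wpM2r// gnd.
under eq_fun do rewrite nnsfun_case.
apply/cvg_lim => //; apply: cvgeZr => //.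
have -> : \int[nu]_y (g y)%:E = \int[nu]_y limn (fun n => (g_ n y)%:E).
  by apply: eq_integral => y _; apply/esym/cvg_lim.
apply: cvg_monotone_convergence => //.
- by move=> n; exact/measurable_EFinP.
- by move=> n y _; rewrite lee_fin.
- by move=> y _ m n mn; rewrite lee_fin gnd.
Qed.

End density.

Section nonneg_integral.
Local Open Scope ereal_scope.
Context d (T : measurableType d) (R : realType) (mu : {measure set T -> \bar R}).
Import HBNNSimple.

(** The integral of a nonnegative function is a supremum over the simple
    functions below it, hence monotone without any measurability.  This compares
    a risk, whose integrand is tau of the singular values, with the integral of
    a measurable function. *)
Lemma ge0_le_integral_nonmeasurable (f g : T -> \bar R) :
  (forall x, 0 <= f x) -> (forall x, f x <= g x) ->
  \int[mu]_x f x <= \int[mu]_x g x.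
Proof.
move=> f0 fg; rewrite !ge0_integralTE//; last by move=> x; exact: le_trans (f0 x) _.
by apply: le_ereal_sup => _ [h hf <-]; exists h => // x; exact: le_trans (hf x) _.
Qed.

End nonneg_integral.

Section product_formula.
Context d (T : measurableType d) (R : realType) (P : probability T R).
Context (I : finType) (Z : I -> {RV P >-> R}).
Hypothesis iidZ : iid_standard_normal Z.

Let indic_case (B : I -> set R) : (forall i, measurable (B i)) ->
  (\int[P]_w (\prod_i \1_(B i) (Z i w))%:E =
   \prod_i normal_prob (0 : R) 1 (B i))%E.
Proof.
move=> mB; have [indep law] := iidZ.
have mZ i : measurable (Z i @^-1` B i) by exact: measurable_funPTI.
pose A := \bigcap_(i in [set i | i \in [set: I]%SET]) (Z i @^-1` B i).
have mA : measurable A.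
  by apply: fin_bigcap_measurable => //; exact: finite_finset.
transitivity (\int[P]_w (\1_A w : R)%:E)%E.
  apply: eq_integral => w _; congr (_ %:E); rewrite indicE.
  case: (pselect (A w)) => Aw.
    rewrite mem_set// big1// => i _; rewrite indicE mem_set//.
    by apply: Aw => /=; rewrite inE.
  rewrite memNset//; apply/eqP/prodf_eq0.
  apply: contrapT => nex; apply: Aw => i _; apply: contrapT => nBi.
  by apply: nex; exists i => //; rewrite indicE memNset.
rewrite integral_indic// setIT.
apply: etrans (indep [set: I]%SET B (fun i _ => mB i)) _.
rewrite (eq_bigl xpredT); last by move=> i; rewrite inE.
by apply: eq_bigr => i _; exact: law.
Qed.

(** Independence is only assumed for events.  The factors are turned from
    indicators into general functions one coordinate at a time; the induction
    is on the set [J] of coordinates that are not yet indicators. *)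
Lemma iid_integral_prod (g : I -> R -> R) (a : I -> R) :
  (forall i, measurable_fun setT (g i)) -> (forall i x, 0 <= g i x) ->
  (forall i, (\int[normal_prob (0 : R) 1]_x (g i x)%:E = (a i)%:E)%E) ->
  (\int[P]_w (\prod_i g i (Z i w))%:E = (\prod_i a i)%:E)%E.
Proof.
move=> mg g0 ga.
have a0 i : 0 <= a i.
  by rewrite -lee_fin -ga; apply: integral_ge0 => x _; rewrite lee_fin.
have [n leJ] := ubnP #|[set: I]%SET|.
have : forall i, i \notin [set: I]%SET ->
  exists B, measurable B /\ g i = \1_B by move=> i; rewrite inE.
elim: n [set: I]%SET leJ g a mg g0 ga a0 => // n IH J.
rewrite ltnS => leJ g a mg g0 ga a0 Jind; have [J0|[i0 i0J]] := set_0Vmem J.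
  have /choice[B Bg] : forall i, exists B, measurable B /\ g i = \1_B.
    by move=> i; apply: Jind; rewrite J0 inE.
  transitivity (\int[P]_w (\prod_i \1_(B i) (Z i w))%:E)%E.
    by apply: eq_integral => w _; congr (_ %:E); apply: eq_bigr => i _;
      have [_ ->] := Bg i.
  rewrite indic_case; last by move=> i; case: (Bg i).
  rewrite -prodEFin; apply: eq_bigr => i _; rewrite -ga.
  by have [mB ->] := Bg i; rewrite integral_indic// setIT.
pose H w := \prod_(i | i != i0) g i (Z i w).
pose c := \prod_(i | i != i0) a i.
have c0 : 0 <= c by exact: prodr_ge0.
transitivity (\int[P]_w (g i0 (Z i0 w) * H w)%:E)%E.
  by apply: eq_integral => w _; rewrite [in LHS](bigD1 i0).
rewrite (@ge0_integral_density _ _ _ _ _ _ (normal_prob (0 : R) 1) _ _ c)//.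
- by rewrite ga -EFinM; congr (_%:E); rewrite [in RHS](bigD1 i0).
- exact: (measurable_funPT (Z i0)).
- rewrite /H; under eq_fun do rewrite -big_filter.
  by apply: measurable_prod => i _; exact: measurableT_comp.
- by move=> w; apply: prodr_ge0.
- move=> B mB.
  pose g' (i : I) : R -> R := if i == i0 then \1_B else g i.
  pose a' i := if i == i0 then fine (normal_prob (0 : R) 1 B) else a i.
  have PB : ((fine (normal_prob (0 : R) 1 B))%:E = normal_prob (0 : R) 1 B)%E.
    by rewrite fineK// fin_num_measure.
  have leJ' : (#|J :\ i0| < n)%N.
    by rewrite (leq_trans _ leJ)// [leqRHS](cardsD1 i0) i0J.
  have := IH (J :\ i0)%SET leJ' g' a'; rewrite /g' /a' => {}IH.
  transitivity (\prod_i (if i == i0 then fine (normal_prob (0 : R) 1 B) else a i))%:E;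
    last first.
    rewrite (bigD1 i0)//= eqxx EFinM PB; congr (_ * _%:E)%E.
    by apply: eq_bigr => i /negPf->.
  rewrite -IH.
  + apply: eq_integral => w _; congr (_%:E); rewrite [in RHS](bigD1 i0)//= eqxx.
    by congr (_ * _); apply: eq_bigr => i /negPf->.
  + by move=> i; case: eqP.
  + by move=> i x; case: eqP.
  + by move=> i; case: eqP => // _; rewrite integral_indic// setIT PB.
  + by move=> i; case: eqP => // _; rewrite fine_ge0.
  + move=> i; rewrite !inE; case: eqP => [_ _|_ /= iJ]; last exact: Jind.
    by exists B.
- exact: mg.
Qed.

End product_formula.

(** * Translations of the normal distribution *)

Section normal_shift.
Context (R : realType).
Local Notation lambda := (@lebesgue_measure R).
Local Notation gauss := (normal_prob (0 : R) 1).
Implicit Types (m x : R) (B : set R) (g : R -> R).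

Lemma normal_pdf_shift m x : normal_pdf m 1 (m + x) = normal_pdf 0 1 x.
Proof. by rewrite !normal_pdfE ?oner_neq0// /normal_fun addrC addKr subr0. Qed.

Lemma normal_pdf_tilt m x :
  normal_pdf m 1 x = expR (m * x - m ^+ 2 / 2) * normal_pdf 0 1 x.
Proof.
rewrite !normal_pdfE ?oner_neq0// mulrCA; congr (_ * _).
by rewrite /normal_fun -expRD; congr expR; field.
Qed.

Lemma integral_normal_prob g : measurable_fun setT g -> (forall x, 0 <= g x) ->
  (\int[gauss]_x (g x)%:E = \int[lambda]_x (g x * normal_pdf 0 1 x)%:E)%E.
Proof.
move=> mg g0; apply/esym.
rewrite (@ge0_integral_density _ _ _ _ R lambda gauss id _ 1)//.
- by rewrite mule1.
- exact: measurable_normal_pdf.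
- by move=> x; exact: normal_pdf_ge0.
- by move=> B mB; rewrite mule1 integral_indicM.
Qed.

Let measurable_translation m :
  measurable_fun setT (fun x : measurableTypeR R => m + x : measurableTypeR R).
Proof. exact: measurable_funD. Qed.

Local Notation translation m :=
  (fun x : measurableTypeR R => m + x : measurableTypeR R).

Lemma lebesgue_measure_shift m B : measurable B ->
  lambda ((fun x => m + x) @^-1` B) = lambda B.
Proof.
move=> mB; apply/esym.
apply: (@lebesgue_measure_unique R
  (pushforward lambda (translation m))) => // _ [[a b]] _ <-.
have pre : translation m @^-1` `]a, b]%classic = `]a - m, b - m]%classic.
  by apply/seteqP; split=> x /=; rewrite !in_itv/= ltrBlDl lerBrDl.
apply: etrans _ (congr1 lambda (esym pre)).
rewrite !lebesgue_measure_itv/= !lte_fin ltrD2r.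
by case: ifP => // _; rewrite -!EFinB; congr (_%:E); ring.
Qed.

Lemma ge0_integral_shift m B g : measurable B -> measurable_fun setT g ->
  (forall x, 0 <= g x) ->
  (\int[lambda]_(x in (fun x => (m + x)%R) @^-1` B) (g (m + x)%R)%:E =
   \int[lambda]_(x in B) (g x)%:E)%E.
Proof.
move=> mB mg g0.
have mEg : measurable_fun B (EFin \o g).
  by apply/measurable_EFinP; exact: measurable_funTS mg.
have Eg0 : {in B, forall y, 0 <= (EFin \o g) y}%E.
  by move=> y _; rewrite lee_fin.
have H1 := @ge0_integral_pushforward _ _ _ _ R (translation m)
  (measurable_translation m) lambda B (EFin \o g) mB mEg Eg0.
have H2 := @eq_measure_integral _ (measurableTypeR R) R B lambda
  (pushforward lambda (translation m)) (EFin \o g)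
  (fun A mA _ => lebesgue_measure_shift m mA).
exact: etrans (esym H1) (H2 (measurable_translation m)).
Qed.

(** Cameron-Martin formula in dimension one: a translation of the standard
    normal law amounts to an exponential tilt. *)
Lemma normal_prob_shift m B : measurable B ->
  (gauss ((fun x => (m + x)%R) @^-1` B) =
   \int[gauss]_x (\1_B x * expR (m * x - m ^+ 2 / 2))%:E)%E.
Proof.
move=> mB.
transitivity (\int[lambda]_(y in B) (normal_pdf m 1 y)%:E)%E; last first.
  rewrite integral_normal_prob; last 2 first.
  - apply: measurable_funM => //; apply: measurableT_comp => //.
    by apply: measurable_funB => //; exact: measurable_funM.
  - by move=> x; rewrite mulr_ge0 ?expR_ge0.
  rewrite -integral_indicM; apply: eq_integral => x _.
  by rewrite normal_pdf_tilt mulrA.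
rewrite -(ge0_integral_shift m mB); last 2 first.
- exact: measurable_normal_pdf.
- exact: normal_pdf_ge0.
by apply: eq_integral => x _ /=; rewrite normal_pdf_shift.
Qed.

Lemma normal_mgf m : (\int[gauss]_x (expR (m * x))%:E = (expR (m ^+ 2 / 2))%:E)%E.
Proof.
rewrite integral_normal_prob; last 2 first.
- by apply: measurableT_comp => //; exact: measurable_funM.
- by move=> x; exact: expR_ge0.
transitivity (\int[lambda]_x ((expR (m ^+ 2 / 2))%:E * (normal_pdf m 1 x)%:E))%E.
  apply: eq_integral => x _; rewrite -EFinM; congr (_%:E).
  by rewrite (normal_pdf_tilt m) mulrA -expRD addrCA subrr addr0.
rewrite ge0_integralZl//.
- by rewrite integral_normal_pdf mule1.
- by apply/measurable_EFinP; exact: measurable_normal_pdf.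
- by move=> x _; rewrite lee_fin normal_pdf_ge0.
Qed.

End normal_shift.

(** * The Borel sigma-algebra of a matrix space *)

Section borel_matrix.
Context (R : realType) (k s : nat).
Local Notation mat := (borel_matrix R k s).

Definition box (B : 'I_k * 'I_s -> set R) : set 'M[R]_(k, s) :=
  [set M | forall p, B p (M p.1 p.2)].

Definition boxes : set (set 'M[R]_(k, s)) :=
  [set box B | B in [set B | forall p, measurable (B p)]].

Lemma boxI B B' : box B `&` box B' = box (fun p => B p `&` B' p).
Proof.
apply/seteqP; split=> M.
  by move=> [MB MB'] p; split; [exact: MB|exact: MB'].
by move=> MBB'; split=> p; case: (MBB' p).
Qed.

Lemma indic_box B (M : 'M[R]_(k, s)) :
  \1_(box B) M = \prod_p \1_(B p) (M p.1 p.2) :> R.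
Proof.
rewrite [LHS]indicE; case: (pselect (box B M)) => BM.
  by rewrite mem_set// big1// => p _; rewrite indicE mem_set//; exact: BM.
rewrite memNset//; apply/esym/eqP/prodf_eq0.
apply: contrapT => nex; apply: BM => p; apply: contrapT => nBp.
by apply: nex; exists p => //; rewrite indicE memNset.
Qed.

Lemma measurable_entry (i : 'I_k) (j : 'I_s) :
  measurable_fun setT (fun M : mat => (M : 'M[R]_(k, s)) i j).
Proof.
apply: (measurability _ (RGenOpens.measurableE R)) => _ [_ [a [b ->] <-]].
rewrite setTI; apply: sub_sigma_algebra.
have /continuousP c := @coord_continuous R k s i j.
exact/c/interval_open.
Qed.

(** Second countability: an open set is the union of the cubes with rational
    center and radius 1/(n+1) that it contains, and there are countably many
    of them. *)
Let open_box_union (U : set 'M[R]_(k, s)) : open U ->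
  (measurable : set (set (g_sigma_algebraType boxes))) U.
Proof.
move=> oU.
pose Q (q : 'M[rat]_(k, s) * nat) :=
  box (fun p => ball (ratr (q.1 p.1 p.2) : R) q.2.+1%:R^-1).
pose F n := if unpickle n is Some q then
  if `[< Q q `<=` U >] then Q q else set0 else set0.
have -> : U = \bigcup_n F n.
  apply/seteqP; split=> M; last first.
    by move=> [n _]; rewrite /F; case: unpickle => // q; case: asboolP => //; apply.
  move: oU; rewrite openE => /[apply] /nbhs_ballP[e /= e0 eU].
  have [n ne] : exists n, n.+1%:R^-1 < e / 2.
    by exists (Num.truncn (e / 2)^-1); rewrite invf_plt ?posrE ?divr_gt0// truncnS_gt.
  have n0 : (0 : R) < n.+1%:R^-1 by rewrite invr_gt0.
  have /choice[q qM] : forall p : 'I_k * 'I_s,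
      exists q : rat, ball (M p.1 p.2) n.+1%:R^-1 (ratr q : R).
    move=> p; have : M p.1 p.2 - n.+1%:R^-1 < M p.1 p.2 + n.+1%:R^-1.
      by rewrite ltrBlDr -addrA ltrDl addr_gt0.
    move=> /rat_in_itvoo[q]; rewrite in_itv => /andP[/= q1 q2].
    by exists q; rewrite /ball/= ltr_distlC; apply/andP.
  exists (pickle (\matrix_(i, j) q (i, j) : 'M[rat]_(k, s), n)) => //.
  rewrite /F pickleK ifT.
    by move=> -[i j] /=; rewrite mxE; apply/ball_sym/(qM (i, j)).
  apply/asboolP => N NQ; apply: eU; split => // i j.
  have := NQ (i, j); rewrite /= mxE => qN.
  apply: (@le_ball _ _ _ (n.+1%:R^-1 + n.+1%:R^-1)).
    by rewrite (splitr e) lerD// ltW.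
  exact: ball_triangle (qM (i, j)) qN.
apply: bigcupT_measurable => n; rewrite /F; case: unpickle => [q|//].
case: ifP => // _; apply: sub_sigma_algebra; eexists; last reflexivity.
by move=> p /=; exact: measurable_ball.
Qed.

(** Boxes are stable under intersection, so that equality of two finite
    measures on matrices can be tested on products of Borel sets. *)
Lemma borel_matrixE : (measurable : set (set mat)) = <<s boxes >>.
Proof.
apply/seteqP; split.
  apply: smallest_sub; first exact: smallest_sigma_algebra.
  exact: open_box_union.
apply: smallest_sub; first exact: smallest_sigma_algebra.
move=> _ [B mB <-].
rewrite (_ : box B = \bigcap_(p in [set: 'I_k * 'I_s])
    ((fun M : 'M[R]_(k, s) => M p.1 p.2) @^-1` B p)); last first.
  apply/seteqP; split=> M; first by move=> MB p _; exact: MB.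
  by move=> MB p; exact: MB.
apply: (@fin_bigcap_measurable _ mat) => // p _.
by rewrite -[X in measurable X]setTI; exact: measurable_entry.
Qed.

Lemma measurable_into_matrix d (T : measurableType d) (f : T -> 'M[R]_(k, s)) :
  (forall i j, measurable_fun setT (fun w => f w i j)) ->
  measurable_fun setT (f : T -> mat).
Proof.
move=> mf; apply: (measurability _ borel_matrixE) => _ [_ [B mB <-] <-].
rewrite setTI (_ : f @^-1` box B = \bigcap_(p in [set: 'I_k * 'I_s])
    ((fun w => f w p.1 p.2) @^-1` B p)); last first.
  apply/seteqP; split=> M; first by move=> MB p _; exact: MB.
  by move=> MB p; exact: MB.
apply: fin_bigcap_measurable => // p _.
by rewrite -[X in measurable X]setTI; exact: mf.
Qed.

End borel_matrix.

(** * Change of measure for Gaussian matrices *)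

Section density_measure.
Local Open Scope ereal_scope.
Context d (T : measurableType d) (R : realType) (mu : {measure set T -> \bar R}).
Variable H : T -> R.

Definition density_measure (mH : measurable_fun setT H)
  (H0 : forall x, (0 <= H x)%R) (A : set T) : \bar R :=
  \int[mu]_(x in A) (H x)%:E.

Hypotheses (mH : measurable_fun setT H) (H0 : forall x, (0 <= H x)%R).
Local Notation nu := (density_measure mH H0).

Let nu0 : nu set0 = 0. Proof. exact: integral_set0. Qed.

Let nu_ge0 A : 0 <= nu A.
Proof. by apply: integral_ge0 => x _; rewrite lee_fin. Qed.

Let nu_sigma_additive : semi_sigma_additive nu.
Proof.
move=> F mF tF mUF; rewrite /density_measure ge0_integral_bigcup//.
- apply: is_cvg_ereal_nneg_natsum_cond => n _ _.
  by apply: integral_ge0 => x _; rewrite lee_fin.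
- by apply/measurable_EFinP; exact: measurable_funTS.
- by move=> x _; rewrite lee_fin.
Qed.

HB.instance Definition _ := isMeasure.Build _ _ _ nu nu0 nu_ge0 nu_sigma_additive.

Lemma ge0_integral_density_measure (g : T -> R) :
  measurable_fun setT g -> (forall x, (0 <= g x)%R) ->
  \int[nu]_x (g x)%:E = \int[mu]_x (g x * H x)%:E.
Proof.
move=> mg g0; rewrite (@ge0_integral_density _ _ _ _ _ mu nu id H 1)// ?mule1//.
by move=> B mB; rewrite mule1 integral_indicM.
Qed.

End density_measure.

Section change_of_measure.
Context d (T : measurableType d) (R : realType) (P : probability T R).
Context (k s : nat) (Z : 'I_k * 'I_s -> {RV P >-> R}).
Hypothesis iidZ : iid_standard_normal Z.
Local Notation mat := (borel_matrix R k s).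

Definition likelihood_ratio (M Y : 'M[R]_(k, s)) : R :=
  \prod_p expR (M p.1 p.2 * Y p.1 p.2 - M p.1 p.2 ^+ 2 / 2).

Let L M w := likelihood_ratio M (noise_matrix Z w).

Let LE M w : L M w = \prod_p expR (M p.1 p.2 * Z p w - M p.1 p.2 ^+ 2 / 2).
Proof. by apply: eq_bigr => -[i j] _; rewrite mxE. Qed.

Let mtilt (m : R) : measurable_fun setT (fun x : R => expR (m * x - m ^+ 2 / 2)).
Proof.
by apply: measurableT_comp => //; apply: measurable_funB.
Qed.

Lemma measurable_likelihood_ratio M : measurable_fun setT (L M).
Proof.
rewrite (_ : L M = fun w =>
  \prod_p expR (M p.1 p.2 * Z p w - M p.1 p.2 ^+ 2 / 2)); last first.
  by apply/funext => w; exact: LE.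
apply: measurable_prod => p _; exact: (measurableT_comp (mtilt (M p.1 p.2))).
Qed.

Let L0 M w : 0 <= L M w.
Proof. by rewrite LE; apply: prodr_ge0 => p _; exact: expR_ge0. Qed.

Lemma measurable_noise M :
  measurable_fun setT (fun w => M + noise_matrix Z w : mat).
Proof.
apply: measurable_into_matrix => i j.
rewrite (_ : (fun w => _) = fun w => M i j + Z (i, j) w).
  exact: measurable_funD.
by apply/funext => w; rewrite !mxE.
Qed.

(** On a box both sides factor over the entries, which reduces the identity of
    laws to the scalar translation formula. *)
Let law_box M (B : 'I_k * 'I_s -> set R) : (forall p, measurable (B p)) ->
  (P ((fun w => (M + noise_matrix Z w)%R) @^-1` box B) =
   density_measure P (measurable_likelihood_ratio M) (L0 M)
     (noise_matrix Z @^-1` box B))%E.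
Proof.
move=> mB.
have mBs p : measurable ((fun x => M p.1 p.2 + x) @^-1` B p).
  rewrite -[X in measurable X]setTI.
  have : measurable_fun setT (fun x : R => M p.1 p.2 + x) by exact: measurable_funD.
  exact.
have fin p : (normal_prob (0 : R) 1 ((fun x => M p.1 p.2 + x)%R @^-1` B p)
   \is a fin_num)%E by apply: fin_num_measure; exact: mBs.
transitivity (\prod_p fine (normal_prob (0 : R) 1
    ((fun x => M p.1 p.2 + x)%R @^-1` B p)))%:E.
  rewrite -(iid_integral_prod iidZ
    (g := fun p => \1_((fun x => M p.1 p.2 + x)%R @^-1` B p)))//; last first.
    move=> p; rewrite fineK// integral_indic//; last exact: mBs.
    by congr (normal_prob _ _ _); exact: setIT.
  have mpre : measurable ((fun w => M + noise_matrix Z w) @^-1` box B).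
    rewrite -[X in measurable X]setTI; apply: measurable_noise => //.
    by rewrite borel_matrixE; apply: sub_sigma_algebra; exists B.
  transitivity (\int[P]_w
      (\1_((fun w => M + noise_matrix Z w)%R @^-1` box B) w : R)%:E)%E.
    by rewrite integral_indic// setIT.
  apply: eq_integral => w _; congr (_%:E).
  transitivity (\1_(box B) (M + noise_matrix Z w) : R).
    by rewrite !indicE; congr (_%:R); apply/idP/idP; rewrite !inE.
  rewrite indic_box; apply: eq_bigr => -[i j] _; rewrite /= !mxE !indicE.
  by congr (_%:R); apply/idP/idP; rewrite !inE.
rewrite -(iid_integral_prod iidZ
  (g := fun p x => \1_(B p) x * expR (M p.1 p.2 * x - M p.1 p.2 ^+ 2 / 2))).
- rewrite /density_measure -integral_indicM; apply: eq_integral => w _.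
  rewrite big_split/= -LE; congr (_ * _)%:E.
  transitivity (\1_(box B) (noise_matrix Z w) : R).
    by rewrite indic_box; apply: eq_bigr => -[i j] _; rewrite mxE.
  by rewrite !indicE; congr (_%:R); apply/idP/idP; rewrite !inE.
- by move=> p; apply: measurable_funM.
- by move=> p x; rewrite mulr_ge0// expR_ge0.
- by move=> p; rewrite fineK// normal_prob_shift.
Qed.

(** All the laws of [M + Z] become densities with respect to the single law of
    [Z]; this is what lets the losses at different [M] be compared at one and
    the same observation. *)
Lemma gaussian_change_of_measure M (h : 'M[R]_(k, s) -> R) :
  measurable_fun setT (h : mat -> R) -> (forall Y, 0 <= h Y) ->
  (\int[P]_w (h (M + noise_matrix Z w)%R)%:E =
   \int[P]_w (h (noise_matrix Z w) * likelihood_ratio M (noise_matrix Z w))%:E)%E.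
Proof.
move=> mh h0.
have mN0 : measurable_fun setT (noise_matrix Z : T -> mat).
  have := measurable_noise 0; congr measurable_fun; apply/funext => w.
  exact: add0r.
pose nu := density_measure P (measurable_likelihood_ratio M) (L0 M).
transitivity (\int[nu]_w (h (noise_matrix Z w))%:E)%E; last first.
  apply: ge0_integral_density_measure => //.
  exact: (measurableT_comp mh).
have mEh : measurable_fun setT (EFin \o h : mat -> \bar R) by exact/measurable_EFinP.
have Eh0 : {in (setT : set mat), forall y, 0 <= (EFin \o h) y}%E.
  by move=> y _; rewrite lee_fin.
have H1 := @ge0_integral_pushforward _ _ T mat R _ (measurable_noise M) P _ _
  measurableT mEh Eh0.
have H2 := @ge0_integral_pushforward _ _ T mat R _ mN0 nu _ _
  measurableT mEh Eh0.
rewrite preimage_setT in H1; rewrite preimage_setT in H2.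
apply: etrans (esym H1) _; apply: etrans _ H2.
have H3 := @eq_measure_integral _ mat R setT
  (pushforward nu (noise_matrix Z : T -> mat))
  (pushforward P (fun w => M + noise_matrix Z w : mat)) (EFin \o h).
apply: (H3 mN0 (measurable_noise M)) => A mA _.
have H4 := @measure_unique _ R mat (@boxes R k s) (fun=> setT)
  (@borel_matrixE R k s) _ _ _
  (pushforward P (fun w => M + noise_matrix Z w : mat))
  (pushforward nu (noise_matrix Z : T -> mat)).
apply: (H4 _ _ _ (measurable_noise M) mN0) => //.
- move=> _ _ [B mB <-] [B' mB' <-]; rewrite boxI; eexists; last reflexivity.
  by move=> p; exact: measurableI.
- move=> _; exists (fun=> setT) => //.
  by apply/seteqP; split.
- by apply/seteqP; split => // Y _; exists 0%N.
- by move=> _ [B mB <-]; exact: law_box.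
- by move=> _; exact: le_lt_trans (probability_le1 P (@measurableT _ T)) (ltry 1).
Qed.

End change_of_measure.

(** * Symmetric gauge functions *)

Section gauge.
Context (R : realType) (n : nat) (tau : 'rV[R]_n -> R).
Hypothesis gtau : symmetric_gauge tau.

Lemma gauge0 : tau 0 = 0.
Proof. by rewrite -(scale0r 0) gauge_homogeneous// normr0 mul0r. Qed.

Lemma gauge_ge0 x : 0 <= tau x.
Proof.
have := gauge_triangle gtau x (- x).
rewrite subrr gauge0 -scaleN1r gauge_homogeneous// normrN1 mul1r.
by rewrite -mulr2n pmulrn_lge0.
Qed.

Lemma gauge_sum (I : Type) (r : seq I) (f : I -> 'rV[R]_n) :
  tau (\sum_(i <- r) f i) <= \sum_(i <- r) tau (f i).
Proof.
elim/big_ind2 : _ => [|x1 x2 y1 y2 h1 h2|//]; first by rewrite gauge0.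
exact: le_trans (gauge_triangle gtau _ _) (lerD h1 h2).
Qed.

(** The average of all permutations of [x] is the constant vector equal to the
    mean of [x]; convexity and permutation invariance conclude. *)
Lemma gauge_mean (x : 'rV[R]_n) :
  tau (const_mx 1) * `|\sum_i x 0 i| <= n%:R * tau x.
Proof.
have [n0|n_gt0] := posnP n.
  rewrite big1 => [|i _]; last by have := ltn_ord i; rewrite {2}n0.
  have -> : n%:R = 0 :> R by rewrite n0.
  by rewrite normr0 mulr0 mul0r.
pose i0 := Ordinal n_gt0.
pose S := \sum_(p : 'S_n) col_perm p x.
have Sconst i : S 0 i = S 0 i0.
  rewrite /S !summxE (reindex_inj (mulgI (tperm i i0)))/=.
  by apply: eq_bigr => p _; rewrite !mxE permM tpermL.
have Ssum : n%:R * S 0 i0 = #|'S_n|%:R * \sum_i x 0 i.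
  transitivity (\sum_i S 0 i).
    by under eq_bigr do rewrite Sconst; rewrite sumr_const card_ord mulr_natl.
  under eq_bigr do rewrite summxE.
  rewrite exchange_big/= mulr_natl -sumr_const; apply: eq_bigr => p _.
  rewrite (reindex_inj (@perm_inj _ p^-1%g)).
  by apply: eq_bigr => i _; rewrite mxE permKV.
have tS : tau S <= #|'S_n|%:R * tau x.
  apply: le_trans (gauge_sum _ _) _; rewrite mulr_natl -sumr_const.
  by apply: ler_sum => p _; rewrite gauge_perm.
have SE : S = S 0 i0 *: const_mx 1.
  by apply/rowP => i; rewrite !mxE mulr1 Sconst.
have N0 : (0 : R) < #|'S_n|%:R by rewrite ltr0n card_Sn fact_gt0.
move: tS; rewrite {1}SE gauge_homogeneous// => tS.
have -> : `|\sum_i x 0 i| = n%:R / #|'S_n|%:R * `|S 0 i0|.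
  apply: (mulfI (lt0r_neq0 N0)); rewrite -{1}(gtr0_norm N0) -normrM -Ssum.
  by rewrite normrM normr_nat; field; exact: lt0r_neq0.
rewrite mulrCA -mulrA ler_wpM2l ?ler0n//.
by rewrite ler_pdivrMl// mulrC.
Qed.

(** Coordinates are replaced by [c] one at a time: a point of a segment between
    two vectors that differ by the sign of one coordinate has a gauge at most
    the common gauge of the endpoints. *)
Lemma gauge_le_sup (x : 'rV[R]_n) c : (forall i, `|x 0 i| <= c) ->
  tau x <= c * tau (const_mx 1).
Proof.
move=> xc.
have main (J : seq 'I_n) : tau x <= tau (\row_i if i \in J then c else x 0 i).
  elim: J => [|j J IH].
    by rewrite le_eqVlt; apply/orP; left; apply/eqP; congr tau;
      apply/rowP => i; rewrite !mxE.
  apply: le_trans IH _.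
  set y := \row_i _; set z := \row_i _.
  have [c0|cpos] := eqVneq c 0.
    suff -> : z = y by [].
    apply/rowP => i; rewrite !mxE in_cons; case: eqP => //= -> .
    case: ifP => // _; rewrite c0; apply/esym/eqP.
    by have := xc j; rewrite c0 normr_le0.
  have c_gt0 : 0 < c.
    by rewrite lt_neqAle eq_sym cpos (le_trans _ (xc j)).
  have yjc : `|y 0 j| <= c by rewrite mxE; case: ifP => // _; rewrite gtr0_norm.
  pose z' := \row_i ((-1) ^+ (i == j) * z 0 i).
  have tz' : tau z' = tau z by exact: (gauge_sign gtau (fun i => i == j)).
  pose th := (c + y 0 j) / (2 * c).
  have th0 : 0 <= th.
    rewrite divr_ge0 ?mulr_ge0// ?(ltW c_gt0)//.
    by move: yjc; rewrite ler_norml => /andP[? _]; rewrite -lerBlDl sub0r.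
  have th1 : 0 <= 1 - th.
    rewrite subr_ge0 ler_pdivrMr ?mulr_gt0// mul1r.
    move: yjc; rewrite ler_norml => /andP[_ ?]; lra.
  have -> : y = th *: z + (1 - th) *: z'.
    apply/rowP => i; rewrite !mxE in_cons.
    have [->|ij]/= := eqVneq i j; last first.
      by rewrite mul1r -mulrDl addrC subrK mul1r.
    rewrite expr1 /th mxE; set v := if _ then _ else _; field.
    by rewrite gt_eqF.
  apply: le_trans (gauge_triangle gtau _ _) _.
  rewrite !gauge_homogeneous// tz' !ger0_norm// -mulrDl addrC subrK mul1r //.
have := main (enum 'I_n); set y := \row_i _ => xy.
apply: le_trans xy _.
have -> : y = c *: const_mx 1.
  by apply/rowP => i; rewrite !mxE mem_enum mulr1.
rewrite gauge_homogeneous//.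
have [n0|n_gt0] := posnP n; last by rewrite ger0_norm// (le_trans _ (xc (Ordinal n_gt0))).
rewrite (_ : const_mx 1 = 0) ?gauge0 ?mulr0//.
by apply/rowP => i; have := ltn_ord i; rewrite {2}n0.
Qed.

End gauge.

(** * Singular values *)

Section real_spectral.
Context (R : realType).

Local Notation re := (@complex.Re R).
Local Notation im := (@complex.Im R).

Let reD (x y : R[i]) : re (x + y) = re x + re y.
Proof. by case: x => a b; case: y. Qed.
Let imD (x y : R[i]) : im (x + y) = im x + im y.
Proof. by case: x => a b; case: y. Qed.
Let re_sum := big_morph re reD (erefl (re 0)).
Let im_sum := big_morph im imD (erefl (im 0)).

Let re_mulC m n p (X : 'M[R[i]]_(m, n)) (Y : 'M[R[i]]_(p, n)) :
  map_mx re (X *m map_mx Num.conj Y^T) =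
  map_mx re X *m (map_mx re Y)^T + map_mx im X *m (map_mx im Y)^T.
Proof.
apply/matrixP => i j; rewrite !mxE re_sum -big_split/=.
apply: eq_bigr => l _; rewrite !mxE.
by case: (X i l) => a b; case: (Y j l) => c d /=; ring.
Qed.

Let re_mulR m n p (X : 'M[R[i]]_(m, n)) (G : 'M[R]_(n, p)) :
  map_mx re (X *m map_mx (real_complex R) G) = map_mx re X *m G.
Proof.
apply/matrixP => i j; rewrite !mxE re_sum; apply: eq_bigr => l _; rewrite !mxE.
by case: (X i l) => a b /=; ring.
Qed.

Let im_mulR m n p (X : 'M[R[i]]_(m, n)) (G : 'M[R]_(n, p)) :
  map_mx im (X *m map_mx (real_complex R) G) = map_mx im X *m G.
Proof.
apply/matrixP => i j; rewrite !mxE im_sum; apply: eq_bigr => l _; rewrite !mxE.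
by case: (X i l) => a b /=; ring.
Qed.

Lemma card_diag_mx_neq0 (F : fieldType) n (d : 'rV[F]_n) :
  (#|[pred j | d 0%R j != 0%R]| <= \rank (diag_mx d))%N.
Proof.
pose J := [pred j | d 0 j != 0%R].
pose f (i : 'I_#|J|) : 'I_n := enum_val i.
have E : mxsub f f (diag_mx d) = diag_mx (\row_i d 0 (f i)).
  by apply/matrixP => i j; rewrite !mxE (inj_eq enum_val_inj).
have : mxsub f f (diag_mx d) \in unitmx.
  rewrite E unitmxE det_diag unitfE; apply/prodf_neq0 => i _.
  by rewrite mxE; exact: (enum_valP i).
move=> /mxrank_unit <-.
have -> : mxsub f f (diag_mx d) = rowsub f 1%:M *m diag_mx d *m colsub f 1%:M.
  by rewrite -rowsubE -mxsub_mul mulmx1.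
exact: leq_trans (mxrankM_maxl _ _) (mxrankM_maxr _ _).
Qed.

(** The unitary diagonalization [P G P^* = diag ev] of the Gram matrix, read on
    the real and imaginary parts [U] and [V] of [P].  Only the real parts of the
    matrix identities are kept, which suffices for traces and diagonal entries
    and keeps the complex numbers out of the sequel.  The last clause holds
    because [G] has rank at most [k]. *)
Lemma gram_spectral k s (A : 'M[R]_(k, s)) (G := A^T *m A)
    (ev := spectral_diag (map_mx (real_complex R) G)) :
  exists U V : 'M[R]_s, [/\
    U^T *m U + V^T *m V = 1%:M,
    forall j, (U *m U^T + V *m V^T) j j = 1,
    forall j, (U *m G *m U^T + V *m G *m V^T) j j = re (ev 0 j) &
    (#|[pred j | re (ev 0%R j) != 0%R]| <= k)%N].
Proof.
set Gc := map_mx _ G in ev *.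
have Gherm : Gc \is hermsymmx.
  apply: realsym_hermsym.
    apply/is_hermitianmxP; rewrite expr0 scale1r map_mx_id//.
    by rewrite /Gc /G map_trmx trmx_mul trmxK.
  by apply/mxOverP => i j; rewrite mxE complex_real.
have /orthomx_spectralP : Gc \is normalmx by exact: hermitian_normalmx.
rewrite -/ev; set P := spectralmx Gc => GE.
have Pu : P \is unitarymx by exact: spectral_unitarymx.
have PP : P *m map_mx Num.conj P^T = 1%:M by exact/unitarymxP.
have PP' : map_mx Num.conj P^T *m P = 1%:M by exact: mulmx1C.
have DE : P *m Gc *m map_mx Num.conj P^T = diag_mx ev.
  rewrite GE invmx_unitary// !mulmxA PP mul1mx -mulmxA PP mulmx1 //.
exists (map_mx re P), (map_mx im P); split.
- have reP : map_mx re (map_mx Num.conj P^T) = (map_mx re P)^T.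
    by apply/matrixP => i j; rewrite !mxE; case: (P j i).
  have imP : map_mx im (map_mx Num.conj P^T) = - (map_mx im P)^T.
    by apply/matrixP => i j; rewrite !mxE; case: (P j i).
  have := re_mulC (map_mx Num.conj P^T) (map_mx Num.conj P^T).
  rewrite reP imP linearN/= mulNmx mulmxN opprK !trmxK => <-.
  rewrite (_ : map_mx Num.conj (map_mx Num.conj P^T)^T = P); last exact: trmxCK.
  by rewrite PP'; apply/matrixP => i j; rewrite !mxE; case: eqP.
- move=> j; rewrite -re_mulC PP !mxE eqxx //.
- by move=> j; rewrite -re_mulR -im_mulR -re_mulC DE !mxE eqxx.
- apply: leq_trans (_ : \rank (diag_mx ev) <= _)%N.
    apply: leq_trans (card_diag_mx_neq0 ev); apply: subset_leq_card.
    by apply/fintype.subsetP => j; rewrite !inE; apply: contra_neq => ->.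
  rewrite -DE; apply: leq_trans (mxrankM_maxl _ _) _.
  apply: leq_trans (mxrankM_maxr _ _) _.
  rewrite mxrank_map; apply: leq_trans (mxrankM_maxl _ _) _.
  exact: rank_leq_col.
Qed.

End real_spectral.

Section singular_values.
Context (R : realType).

Definition sqnorm n (u : 'rV[R]_n) : R := \sum_j u 0 j ^+ 2.

Lemma sqnorm_ge0 n (u : 'rV[R]_n) : 0 <= sqnorm u.
Proof. by apply: sumr_ge0 => j _; exact: sqr_ge0. Qed.

Lemma mulmx_trE m n p (X : 'M[R]_(m, n)) (Y : 'M[R]_(p, n)) i j :
  (X *m Y^T) i j = \sum_l X i l * Y j l.
Proof. by rewrite mxE; apply: eq_bigr => l _; rewrite mxE. Qed.

Lemma gram_diagE m n (X : 'M[R]_(m, n)) i : (X *m X^T) i i = sqnorm (row i X).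
Proof. by rewrite mulmx_trE; apply: eq_bigr => l _; rewrite mxE expr2. Qed.

Lemma sqnorm_row m n (X : 'M[R]_(m, n)) i : sqnorm (row i X) = \sum_l X i l ^+ 2.
Proof. by apply: eq_bigr => l _; rewrite mxE. Qed.

Lemma nonincreasing_tail0 (t : seq R) m : sorted >=%R t ->
  (forall x, x \in t -> 0 <= x) -> (count (fun x => x != 0%R) t <= m)%N ->
  forall i, (m <= i)%N -> t`_i = 0.
Proof.
move=> tsort t0 tm i mi; apply: contrapT => /eqP ti.
have it : (i < size t)%N.
  by rewrite ltnNge; apply: contra_neqN ti => ?; rewrite nth_default.
have : (i < count (fun x => x != 0%R) t)%N; last by rewrite ltnNge (leq_trans tm).
rewrite -(cat_take_drop i.+1 t) count_cat; apply: leq_trans (leq_addr _ _).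
suff : all (fun x => x != 0%R) (take i.+1 t).
  by rewrite all_count => /eqP->; rewrite size_takel.
apply/(all_nthP 0%R) => j; rewrite size_takel// => ji.
rewrite nth_take//.
have tij : t`_i <= t`_j.
  have := sorted_leq_nth (@ge_trans _ R) (@ge_refl _ R) 0 tsort.
  by apply; rewrite ?inE//; apply: leq_ltn_trans it.
apply: lt0r_neq0; apply: lt_le_trans tij.
by rewrite lt_neqAle eq_sym ti t0// mem_nth.
Qed.

(** Cauchy-Schwarz inequality, in the form used on a unit vector [x]. *)
Lemma sum_mul_le_sqrt (I : finType) (x y : I -> R) l : \sum_j x j ^+ 2 <= 1 ->
  \sum_j y j ^+ 2 = l -> \sum_j x j * y j <= Num.sqrt l.
Proof.
move=> x1 yl.
have l0 : 0 <= l by rewrite -yl; apply: sumr_ge0 => j _; exact: sqr_ge0.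
have [lz|lneq] := eqVneq l 0.
  have y0 j : y j = 0.
    apply/eqP; rewrite -sqrf_eq0; apply/eqP.
    move: yl; rewrite lz => /psumr_eq0P-> //.
    by move=> i _; exact: sqr_ge0.
  by rewrite big1 ?sqrtr_ge0// => j _; rewrite y0 mulr0.
set r := Num.sqrt l.
have r0 : 0 < r by rewrite sqrtr_gt0 lt_neqAle eq_sym lneq.
have rr : r * r = l by rewrite -expr2 sqr_sqrtr.
rewrite -(ler_pM2r r0) rr mulr_suml.
have : \sum_j x j * y j * r <= \sum_j (l * x j ^+ 2 + y j ^+ 2) / 2.
  apply: ler_sum => j _.
  have := sqr_ge0 (r * x j - y j); rewrite -rr => ?; nra.
move=> /le_trans; apply; rewrite -mulr_suml big_split/= -mulr_sumr yl.
rewrite ler_pdivrMr//; nra.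
Qed.

Section matrix.
Context (k s : nat) (A : 'M[R]_(k, s)).
Let lam (j : 'I_s) : R :=
  complex.Re (spectral_diag (map_mx (real_complex R) (A^T *m A)) 0 j).

Let svs := sort >=%R [seq Num.sqrt (lam j) | j <- enum 'I_s].

Let lamE (U V : 'M[R]_s) :
    (forall j, (U *m (A^T *m A) *m U^T + V *m (A^T *m A) *m V^T) j j = lam j) ->
  forall j, lam j = sqnorm (row j (U *m A^T)) + sqnorm (row j (V *m A^T)).
Proof.
move=> UVl j; rewrite -UVl mxE -!gram_diagE !trmx_mul !trmxK !mulmxA //.
Qed.

Let svs_mem x : x \in svs -> exists j, x = Num.sqrt (lam j).
Proof. by rewrite mem_sort => /mapP[j _ ->]; exists j. Qed.

(** The definition keeps [minn k s] of the [s] sorted roots; by the rank bound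
    on the Gram matrix the discarded ones vanish. *)
Lemma sum_singular_values : \sum_i singular_values A 0 i = \sum_j Num.sqrt (lam j).
Proof.
have [U [V [_ _ /lamE lamUV lamk]]] := gram_spectral A.
have lam0 j : 0 <= lam j by rewrite lamUV addr_ge0// sqnorm_ge0.
have ssort : sorted >=%R svs by apply: sort_sorted => x y; exact: le_total.
have size_svs : size svs = s by rewrite size_sort size_map size_enum_ord.
have svs0 x : x \in svs -> 0 <= x by move=> /svs_mem[j ->]; exact: sqrtr_ge0.
have cnt : (count (fun x => x != 0%R) svs <= minn k s)%N.
  rewrite leq_min -[X in _ && (_ <= X)%N]size_svs count_size andbT.
  apply: leq_trans lamk; rewrite count_sort count_map cardE.
  apply: (@leq_trans (count (fun j => lam j != 0%R) (enum 'I_s))).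
    apply: sub_count => j /=; apply: contra_neq => ->; exact: sqrtr0.
  by rewrite -size_filter enumT.
have tail := nonincreasing_tail0 ssort svs0 cnt.
transitivity (\sum_(i < s) svs`_i).
  rewrite -(big_mkord xpredT (fun i => svs`_i)).
  rewrite (big_cat_nat (n := minn k s))//= ?geq_minr//.
  rewrite [X in _ + X]big_nat_cond [X in _ + X]big1 ?addr0; last first.
    by move=> i /andP[/andP[/tail]].
  by rewrite big_mkord; apply: eq_bigr => i _; rewrite mxE.
rewrite -[in LHS]size_svs -(big_mkord xpredT (fun i => svs`_i)) -(big_nth 0 xpredT id).
by rewrite (perm_big _ (permEl (perm_sort _ _)))/= big_map big_enum.
Qed.

Lemma singular_values_le L : 0 <= L ->
    (forall u : 'rV[R]_s, sqnorm (u *m A^T) <= L ^+ 2 * sqnorm u) ->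
  forall i, `|singular_values A 0 i| <= L.
Proof.
move=> L0 AL i.
have [U [V [_ UV1 /lamE lamUV _]]] := gram_spectral A.
have : svs`_i \in svs.
  rewrite mem_nth// size_sort size_map size_enum_ord.
  by rewrite (leq_trans (ltn_ord i))// geq_minr.
rewrite mxE -/lam -/svs => /svs_mem[j ->].
rewrite ger0_norm ?sqrtr_ge0// -(ger0_norm L0) -sqrtr_sqr ler_wsqrtr//.
rewrite lamUV !row_mul; apply: le_trans (lerD (AL _) (AL _)) _.
rewrite -mulrDr -[leRHS]mulr1 -(UV1 j) mxE -!gram_diagE !lexx //.
Qed.

(** Easy half of the duality between the nuclear and operator norms.  In the
    eigenbasis of [A^T A] the trace is a sum of scalar products of the images
    under [B] and [A] of unit vectors; the former have norm at most 1, the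
    norms of the latter are the singular values of [A].  The stacked real and imaginary
    parts of an eigenvector play the role of one real unit vector. *)
Lemma nuclear_duality (B : 'M[R]_(k, s)) :
    (forall u : 'rV[R]_s, sqnorm (u *m B^T) <= sqnorm u) ->
  \tr (A *m B^T) <= \sum_i singular_values A 0 i.
Proof.
move=> B1; rewrite sum_singular_values.
have [U [V [UV UV1 /lamE lamUV _]]] := gram_spectral A.
have -> : \tr (A *m B^T) = \sum_j (\sum_l (U *m B^T) j l * (U *m A^T) j l +
   \sum_l (V *m B^T) j l * (V *m A^T) j l).
  rewrite mxtrace_mulC -[B^T *m A]mulmx1 -UV mulmxDr linearD/=.
  rewrite !mulmxA ![\tr (_ *m _ *m _ *m _)]mxtrace_mulC -big_split/=.
  apply: eq_bigr => j _; rewrite -!mulmx_trE !trmx_mul !trmxK !mulmxA //.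
apply: ler_sum => j _.
pose x (i : 'I_k + 'I_k) := match i with inl l => (U *m B^T) j l
  | inr l => (V *m B^T) j l end.
pose y (i : 'I_k + 'I_k) := match i with inl l => (U *m A^T) j l
  | inr l => (V *m A^T) j l end.
have := @sum_mul_le_sqrt ('I_k + 'I_k)%type x y (lam j).
rewrite !big_sumType/=; apply.
  have UVj : sqnorm (row j U) + sqnorm (row j V) = 1.
    by rewrite -(UV1 j) mxE !gram_diagE.
  by rewrite -!sqnorm_row !row_mul -UVj lerD.
by rewrite lamUV !sqnorm_row.
Qed.

End matrix.
End singular_values.

(** * Bounds on unitarily invariant norms *)

Section ui_norm_bounds.
Context (R : realType) (k s : nat) (tau : 'rV[R]_(minn k s) -> R).
Hypothesis gtau : symmetric_gauge tau.

Lemma ui_norm_ge (A B : 'M[R]_(k, s)) :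
    (forall u : 'rV[R]_s, sqnorm (u *m B^T) <= sqnorm u) ->
  tau (const_mx 1) * `|\tr (A *m B^T)| <= (minn k s)%:R * ui_norm tau A.
Proof.
move=> B1; apply: le_trans _ (gauge_mean gtau _).
apply: ler_wpM2l; first exact: gauge_ge0.
apply: le_trans _ (ler_norm _); rewrite ler_norml; apply/andP; split; last first.
  exact: nuclear_duality.
rewrite lerNl -linearN/= -mulmxN -linearN/=; apply: nuclear_duality => u.
rewrite linearN/= mulmxN.
have -> : sqnorm (- (u *m B^T)) = sqnorm (u *m B^T).
  by apply: eq_bigr => j _; rewrite mxE sqrrN.
exact: B1.
Qed.

Lemma ui_norm_le (A : 'M[R]_(k, s)) L : 0 <= L ->
    (forall u : 'rV[R]_s, sqnorm (u *m A^T) <= L ^+ 2 * sqnorm u) ->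
  ui_norm tau A <= L * tau (const_mx 1).
Proof. by move=> L0 AL; apply: gauge_le_sup => // i; exact: singular_values_le. Qed.

End ui_norm_bounds.

Section dual_certificate.
Context (R : realType) (k s : nat) (X : 'M[R]_(k, s)).
Let H := X^T *m X.
Let S := 1%:M + H.

Let dotE n (x y : 'rV[R]_n) : (x *m y^T) 0 0 = \sum_j x 0 j * y 0 j.
Proof. exact: mulmx_trE. Qed.

Let sqE n (x : 'rV[R]_n) : sqnorm x = (x *m x^T) 0 0.
Proof. by rewrite dotE; apply: eq_bigr => j _; rewrite expr2. Qed.

Let Hsym : H^T = H. Proof. by rewrite trmx_mul trmxK. Qed.
Let Ssym : S^T = S. Proof. by rewrite linearD/= trmx1 Hsym. Qed.

Let S_quad (v : 'rV[R]_s) : (v *m S *m v^T) 0 0 = sqnorm v + sqnorm (v *m X^T).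
Proof.
rewrite mulmxDr mulmx1 mulmxDl mxE !sqE; congr (_ + _ 0 0).
by rewrite trmx_mul trmxK !mulmxA.
Qed.

Let Sunit : S \in unitmx.
Proof.
rewrite -row_free_unit -kermx_eq0; apply/rowV0P => v /sub_kermxP vS.
have := S_quad v; rewrite vS mul0mx mxE => /esym/eqP.
rewrite paddr_eq0 ?sqnorm_ge0// => /andP[/eqP v0 _].
apply/rowP => j; rewrite mxE; apply/eqP; rewrite -sqrf_eq0; apply/eqP.
by move/psumr_eq0P : v0 => -> // i _; exact: sqr_ge0.
Qed.

(** On singular values this is the map x |-> 2 x / (1 + x^2), which is bounded
    by 1 and satisfies x * 2 x / (1 + x^2) >= 2 (x^2 - x^4).  It approximates
    the polar factor of [X], which would be the optimal contraction, by a
    rational expression that needs no singular value decomposition. *)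
Definition dual_certificate : 'M[R]_(k, s) := 2 *: (X *m invmx (1%:M + X^T *m X)).
Let B := dual_certificate.

Let trB : B^T = 2 *: (invmx S *m X^T).
Proof. by rewrite /B /dual_certificate linearZ/= trmx_mul trmx_inv Ssym. Qed.

(** With [v = u S^-1] and [a = v X^T], the vector [u] is [v + a X], and the
    claim is the inequality of arithmetic and geometric means applied to the
    scalar product of [v] and [a X], which is |a|^2. *)
Lemma dual_certificate_contraction (u : 'rV[R]_s) :
  sqnorm (u *m B^T) <= sqnorm u.
Proof.
pose v := u *m invmx S; pose a := v *m X^T.
have uE : u = v + a *m X.
  by rewrite -[u](mulmxKV Sunit) -/v mulmxDr mulmx1 /a mulmxA.
have -> : u *m B^T = 2 *: a by rewrite trB -scalemxAr mulmxA.
have va : \sum_j v 0 j * (a *m X) 0 j = sqnorm a.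
  by rewrite -dotE trmx_mul mulmxA sqE.
have -> : sqnorm u = sqnorm v + 2 * sqnorm a + sqnorm (a *m X).
  rewrite -va /sqnorm mulr_sumr -!big_split/=; apply: eq_bigr => j _.
  by rewrite {1}uE mxE; ring.
have -> : sqnorm (2 *: a) = 4 * sqnorm a.
  by rewrite /sqnorm mulr_sumr; apply: eq_bigr => j _; rewrite mxE; ring.
suff : 2 * sqnorm a <= sqnorm v + sqnorm (a *m X) by lra.
rewrite -va /sqnorm mulr_sumr -big_split/=; apply: ler_sum => j _.
have := sqr_ge0 (v 0 j - (a *m X) 0 j); nra.
Qed.

(** Expanding [S^-1 S = 1] twice leaves the remainder tr(S^-1 H^3), the trace of
    a positive semidefinite matrix. *)
Lemma dual_certificate_trace :
  2 * (\tr H - \tr (H *m H)) <= \tr (X *m B^T).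
Proof.
rewrite trB -scalemxAr linearZ/= ler_pM2l//.
pose W := X *m H.
have E1 : \tr (X *m (invmx S *m X^T)) = \tr (invmx S *m H).
  by rewrite mxtrace_mulC -mulmxA.
have E2 : \tr (W *m invmx S *m W^T) = \tr (invmx S *m H *m H *m H).
  by rewrite -mulmxA mxtrace_mulC trmx_mul Hsym -!mulmxA !(mulmxA X^T X) -/H.
have HE : H = invmx S *m H + invmx S *m H *m H.
  have SH : S *m H = H + H *m H by rewrite mulmxDl mul1mx.
  by rewrite -mulmxA -mulmxDr -SH mulKmx.
have trH : \tr H = \tr (invmx S *m H) + \tr (invmx S *m H *m H).
  by rewrite {1}HE linearD.
have trHH : \tr (H *m H) = \tr (invmx S *m H *m H) + \tr (invmx S *m H *m H *m H).
  by rewrite {1}HE mulmxDl linearD.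
suff : 0 <= \tr (W *m invmx S *m W^T) by rewrite E1 E2; lra.
apply: sumr_ge0 => i _.
pose w := row i W; pose v := w *m invmx S.
have -> : (W *m invmx S *m W^T) i i = (v *m S *m v^T) 0 0.
  rewrite mulmx_trE /v mulmxKV// dotE; apply: eq_bigr => l _.
  by rewrite mulrC /w -row_mul !mxE.
by rewrite S_quad addr_ge0// sqnorm_ge0.
Qed.

End dual_certificate.

(** * Differences of coupled random sign matrices *)

Section sign_differences.
Context (R : realType) (k s : nat).
Context (kappa : bool * bool -> R) (r : R).
Hypotheses (kappa_ge0 : forall a, 0 <= kappa a).
Hypotheses (kappa_sum : \sum_a kappa a = 1).
Hypotheses (kappa_tf : kappa (true, false) = r) (kappa_ft : kappa (false, true) = r).

Local Notation I := ('I_k * 'I_s)%type.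
Local Notation pairs := {ffun I -> bool * bool}.

Definition sign_matrix (e : I -> bool) : 'M[R]_(k, s) :=
  \matrix_(i, j) (-1) ^+ e (i, j).

Definition pair_weight (phi : pairs) : R := \prod_p kappa (phi p).

Definition sign_difference (phi : pairs) : 'M[R]_(k, s) :=
  sign_matrix (fun p => (phi p).1) - sign_matrix (fun p => (phi p).2).

Let dif (a : bool * bool) : R := (-1) ^+ a.1 - (-1) ^+ a.2.

Let sdE phi i j : sign_difference phi i j = dif (phi (i, j)).
Proof. by rewrite !mxE. Qed.

Lemma pair_weight_ge0 phi : 0 <= pair_weight phi.
Proof. by apply: prodr_ge0 => p _. Qed.

Let E (g : pairs -> R) := \sum_phi pair_weight phi * g phi.

Let marginal (p0 : I) (g : bool * bool -> R) :
  E (fun phi => g (phi p0)) = \sum_a kappa a * g a.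
Proof.
pose F (p : I) a := kappa a * (if p == p0 then g a else 1).
transitivity (\prod_p \sum_a F p a).
  rewrite bigA_distr_bigA; apply: eq_bigr => phi _.
  rewrite big_split/=; congr (_ * _).
  rewrite (bigD1 p0)//= eqxx big1 ?mulr1// => p /negPf->//.
rewrite (bigD1 p0)//= [X in _ * X]big1 ?mulr1.
  by apply: eq_bigr => a _; rewrite /F eqxx.
move=> p /negPf pp0; rewrite -[RHS]kappa_sum; apply: eq_bigr => a _.
by rewrite /F pp0 mulr1.
Qed.

Lemma pair_weight_sum : \sum_phi pair_weight phi = 1.
Proof.
transitivity (\prod_(p : I) \sum_a kappa a); first by rewrite bigA_distr_bigA.
by rewrite big1.
Qed.

Let second_moment i j : E (fun phi => sign_difference phi i j ^+ 2) = 8 * r.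
Proof.
transitivity (E (fun phi => dif (phi (i, j)) ^+ 2)).
  by apply: eq_bigr => phi _; rewrite sdE.
apply: etrans (marginal (i, j) (fun a => dif a ^+ 2)) _.
rewrite (eq_bigr (fun a => kappa (a.1, a.2) * dif (a.1, a.2) ^+ 2)); last first.
  by case.
rewrite -(pair_bigA _ (fun a b => kappa (a, b) * dif (a, b) ^+ 2))/= !big_bool/=.
by rewrite ?big_bool/= kappa_tf kappa_ft /dif/=; ring.
Qed.

(** Exchanging the two signs at one entry preserves the weights and changes the
    sign of that entry of the difference, so that moments odd in this entry
    vanish. *)
Let swap_at (p0 : I) (phi : pairs) : pairs :=
  [ffun p => if p == p0 then ((phi p).2, (phi p).1) else phi p].

Let swap_atK p0 : involutive (swap_at p0).
Proof.
move=> phi; apply/ffunP => p; rewrite !ffunE; case: eqP => [->|//].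
by case: (phi p0).
Qed.

Let swap_weight p0 phi : pair_weight (swap_at p0 phi) = pair_weight phi.
Proof.
apply: eq_bigr => p _; rewrite ffunE; case: eqP => // _.
by case: (phi p) => -[] [] //=; rewrite ?kappa_tf ?kappa_ft.
Qed.

Let swap_dif p0 phi i j : sign_difference (swap_at p0 phi) i j =
  (if (i, j) == p0 then -1 else 1) * sign_difference phi i j.
Proof.
by rewrite !sdE ffunE; case: eqP => _; rewrite /dif ?mul1r// mulN1r opprB.
Qed.

Let sd4 phi i i' j j' := sign_difference phi i j * sign_difference phi i j' *
  (sign_difference phi i' j * sign_difference phi i' j').

(** When [i != i'] and [j != j'] the entry [(i, j)] occurs once in the product,
    and the exchange of the signs there changes the product into its
    opposite. *)
Let fourth_moment i i' j j' :
  E (fun phi => sd4 phi i i' j j') <= 16 * ((i == i')%:R + (j == j')%:R).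
Proof.
have dif2 a : `|dif a| <= 2 by case: a => -[] []; rewrite /dif/=; rewrite ler_norml; lra.
have ub phi : sd4 phi i i' j j' <= 16.
  apply: le_trans (ler_norm _) _; rewrite /sd4 !normrM !sdE.
  rewrite (_ : 16 = 2 * 2 * (2 * 2)); last by ring.
  by rewrite !ler_pM// ?mulr_ge0.
have Eub : E (fun phi => sd4 phi i i' j j') <= 16.
  apply: (@le_trans _ _ (\sum_phi pair_weight phi * 16)).
    by apply: ler_sum => phi _; rewrite ler_wpM2l// pair_weight_ge0.
  by rewrite -mulr_suml pair_weight_sum mul1r.
have [ii|ii] := eqVneq i i'; first by rewrite (le_trans Eub)//; case: eqP => _ /=; lra.
have [jj|jj] := eqVneq j j'; first by rewrite (le_trans Eub)//=; lra.
rewrite addr0 mulr0.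
suff /eqP : E (fun phi => sd4 phi i i' j j') = - E (fun phi => sd4 phi i i' j j').
  by rewrite -addr_eq0 -mulr2n mulrn_eq0/= => /eqP->.
rewrite {1}/E (reindex_inj (can_inj (swap_atK (i, j)))) /E -sumrN.
apply: eq_bigr => phi _; rewrite swap_weight /sd4 !swap_dif.
rewrite !xpair_eqE !eqxx/= ![_ == i]eq_sym ![_ == j]eq_sym (negPf ii) (negPf jj)/=.
by rewrite !mul1r mulN1r !mulNr mulrN.
Qed.

Let sum_eq_ord n : \sum_(i < n) \sum_(i' < n) (i == i')%:R = n%:R :> R.
Proof.
under eq_bigr => i _.
  rewrite (bigD1 i)//= eqxx big1 ?addr0; last first.
    by move=> i'; rewrite eq_sym => /negPf->.
  over.
by rewrite sumr_const card_ord.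
Qed.

Let E_sum (A : finType) (F : A -> pairs -> R) :
  E (fun phi => \sum_a F a phi) = \sum_a E (F a).
Proof. by rewrite /E exchange_big/=; apply: eq_bigr => phi _; rewrite mulr_sumr. Qed.

(** The fourth moment of the singular values involves k s^2 + k^2 s index
    quadruples, at most 2 k s (maxn k s); this is of the same order as the
    second moment times [t ^+ 2] when [t] is of order sqrt (maxn k s). *)
Lemma expected_dual_gap (t : R) : 0 < t ->
  2 * t * (8 * r * (k * s)%:R / t ^+ 2 - 32 * (k * s * maxn k s)%:R / t ^+ 4) <=
  \sum_phi pair_weight phi *
    `|\tr (sign_difference phi *m
           (dual_certificate (t^-1 *: sign_difference phi))^T)|.
Proof.
move=> t0.
pose H phi := (t^-1 *: sign_difference phi)^T *m (t^-1 *: sign_difference phi).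
apply: (@le_trans _ _ (\sum_phi pair_weight phi *
    (2 * t * (\tr (H phi) - \tr (H phi *m H phi))))); last first.
  apply: ler_sum => phi _; rewrite ler_wpM2l ?pair_weight_ge0//.
  apply: le_trans (ler_norm _).
  have := dual_certificate_trace (t^-1 *: sign_difference phi).
  rewrite -/(H phi) -scalemxAl linearZ/= -(ler_pM2l t0) [leRHS]mulrA.
  by rewrite mulfV ?gt_eqF// mul1r mulrA [t * 2]mulrC.
have trH phi : \tr (H phi) =
    \sum_j \sum_i t ^- 2 * sign_difference phi i j ^+ 2.
  apply: eq_bigr => j _; rewrite mxE; apply: eq_bigr => i _.
  by rewrite mxE [in X in _ * X]mxE mxE; field; exact: lt0r_neq0.
have trHH phi : \tr (H phi *m H phi) =
    \sum_j \sum_j' \sum_i \sum_i' t ^- 4 * sd4 phi i i' j j'.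
  apply: eq_bigr => j _; rewrite mxE; apply: eq_bigr => j' _.
  rewrite !mxE mulr_suml; apply: eq_bigr => i _; rewrite mulr_sumr.
  apply: eq_bigr => i' _; rewrite !mxE /sd4 !mxE; field; exact: lt0r_neq0.
have ExpH : \sum_phi pair_weight phi * \tr (H phi) = 8 * r * (k * s)%:R / t ^+ 2.
  under eq_bigr do rewrite trH mulr_sumr.
  rewrite exchange_big/=.
  transitivity (\sum_(j < s) \sum_(i < k) (8 * r / t ^+ 2)).
    apply: eq_bigr => j _; under eq_bigr do rewrite mulr_sumr.
    rewrite exchange_big/=; apply: eq_bigr => i _.
    rewrite -(second_moment i j) /E mulr_suml; apply: eq_bigr => phi _.
    by rewrite mulrA mulrAC.
  rewrite !sumr_const !card_ord -mulrnA -mulr_natr; field; exact: lt0r_neq0.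
have ExpHH : \sum_phi pair_weight phi * \tr (H phi *m H phi) <=
    32 * (k * s * maxn k s)%:R / t ^+ 4.
  have -> : \sum_phi pair_weight phi * \tr (H phi *m H phi) =
      E (fun phi => \sum_j \sum_j' \sum_i \sum_i' t ^- 4 * sd4 phi i i' j j').
    by apply: eq_bigr => phi _; rewrite trHH.
  apply: (@le_trans _ _ (\sum_(j < s) \sum_(j' < s) \sum_(i < k) \sum_(i' < k)
      t ^- 4 * (16 * ((i == i')%:R + (j == j')%:R)))).
    rewrite E_sum; apply: ler_sum => j _; rewrite E_sum; apply: ler_sum => j' _.
    rewrite E_sum; apply: ler_sum => i _; rewrite E_sum; apply: ler_sum => i' _.
    apply: le_trans (ler_wpM2l _ (fourth_moment i i' j j')); last first.
      by rewrite invr_ge0 exprn_ge0// ltW.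
    by rewrite /E mulr_sumr le_eqVlt; apply/orP; left; apply/eqP;
      apply: eq_bigr => phi _; rewrite mulrCA.
  under eq_bigr do under eq_bigr do (under eq_bigr do rewrite -!mulr_sumr;
    rewrite -!mulr_sumr).
  under eq_bigr do rewrite -!mulr_sumr; rewrite -!mulr_sumr.
  rewrite [leRHS]mulrC ler_wpM2l ?invr_ge0 ?exprn_ge0 ?(ltW t0)//.
  have -> : \sum_(j < s) \sum_(j' < s) \sum_(i < k) \sum_(i' < k)
     ((i == i')%:R + (j == j')%:R) = s%:R * s%:R * k%:R + s%:R * (k%:R * k%:R) :> R.
    transitivity (\sum_(j < s) \sum_(j' < s)
        (k%:R + (j == j')%:R * (k%:R * k%:R) : R)).
      apply: eq_bigr => j _; apply: eq_bigr => j' _.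
      transitivity (\sum_(i < k) (\sum_(i' < k) (i == i')%:R +
          (j == j')%:R * k%:R : R)).
        apply: eq_bigr => i _; rewrite big_split/= sumr_const card_ord.
        by rewrite mulr_natr.
      by rewrite big_split/= sum_eq_ord sumr_const card_ord; ring.
    transitivity (\sum_(j < s) (s%:R * k%:R +
        (\sum_(j' < s) (j == j')%:R) * (k%:R * k%:R) : R)).
      apply: eq_bigr => j _; rewrite big_split/= -mulr_suml sumr_const card_ord; ring.
    by rewrite big_split/= -[X in _ + X]mulr_suml sum_eq_ord sumr_const card_ord; ring.
  rewrite !natrM.
  have := leq_maxl k s; have := leq_maxr k s.
  rewrite -!(ler_nat R); move: (maxn k s) => n sn kn.
  have := ler0n R k; have := ler0n R s; move=> s0 k0.
  have : 0 <= k%:R * s%:R :> R by rewrite mulr_ge0.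
  nra.
have -> : \sum_phi pair_weight phi * (2 * t * (\tr (H phi) - \tr (H phi *m H phi)))
  = 2 * t * (\sum_phi pair_weight phi * \tr (H phi)
     - \sum_phi pair_weight phi * \tr (H phi *m H phi)).
  rewrite -sumrB mulr_sumr; apply: eq_bigr => phi _; ring.
rewrite ler_pM2l ?mulr_gt0// ExpH lerD2l lerN2 //.
Qed.

End sign_differences.

(** * The posterior law of one sign *)

Section posterior.
Context (R : realType).
Local Notation gauss := (normal_prob (0 : R) 1).

(** Prior mass 1/2 times the density of N(+-1, 1) relative to N(0, 1), the sign
    being + for [false].  The redundant square of the sign is the m^2 of the
    tilt. *)
Definition sign_likelihood (a : bool) (y : R) : R :=
  expR ((-1) ^+ a * y - ((-1) ^+ a) ^+ 2 / 2) / 2.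
Local Notation u := sign_likelihood.

Definition sign_evidence (y : R) : R := u true y + u false y.

Definition posterior_pair (a : bool * bool) (y : R) : R :=
  u a.1 y * u a.2 y / sign_evidence y.
Local Notation v := posterior_pair.

(** Joint law of two independent draws from the posterior of one sign, the
    observation following its marginal law: [sign_evidence] is the density of
    that marginal relative to N(0, 1). *)
Definition sign_coupling (a : bool * bool) : R :=
  fine (\int[gauss]_y (v a y)%:E)%E.

Lemma sign_likelihood_gt0 a y : 0 < u a y.
Proof. by rewrite divr_gt0// expR_gt0. Qed.

Lemma sign_evidence_gt0 y : 0 < sign_evidence y.
Proof. by rewrite addr_gt0// sign_likelihood_gt0. Qed.

Lemma posterior_pair_ge0 a y : 0 <= v a y.
Proof.
by rewrite !mulr_ge0// ?invr_ge0 ltW// ?sign_likelihood_gt0// sign_evidence_gt0.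
Qed.

Lemma measurable_sign_likelihood a : measurable_fun setT (u a).
Proof.
apply: measurable_funM => //; apply: measurableT_comp => //.
by apply: measurable_funB.
Qed.

Lemma measurable_posterior_pair a : measurable_fun setT (v a).
Proof.
apply: measurable_funM.
  by apply: measurable_funM; exact: measurable_sign_likelihood.
rewrite (_ : (fun y => _) = fun y => (sign_evidence y) `^ (-1)); last first.
  by apply/funext => y; rewrite powR_inv1// ltW// sign_evidence_gt0.
apply: (measurableT_comp (measurable_powR _)).
by apply: measurable_funD; exact: measurable_sign_likelihood.
Qed.

Lemma integral_sign_likelihood a : (\int[gauss]_y (u a y)%:E = (1 / 2)%:E)%E.
Proof.
pose m : R := (-1) ^+ a.
under eq_integral => y _ do rewrite /u expRD mulrAC -mulrA mulrC EFinM.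
rewrite ge0_integralZl//=.
  by rewrite normal_mgf -EFinM -mulrA -expRD addNr expR0 mulr1 div1r.
by apply/measurable_EFinP; apply: measurableT_comp => //; exact: measurable_funM.
Qed.

Lemma posterior_pair_le a y : v a y <= u a.1 y.
Proof.
rewrite /v -mulrA ler_piMr ?(ltW (sign_likelihood_gt0 _ _))//.
rewrite ler_pdivrMr ?sign_evidence_gt0// mul1r /sign_evidence.
have := sign_likelihood_gt0 true y; have := sign_likelihood_gt0 false y.
by case: (a.2); lra.
Qed.

Lemma integral_posterior_pair a :
  (\int[gauss]_y (v a y)%:E = (sign_coupling a)%:E)%E.
Proof.
rewrite /sign_coupling fineK// ge0_fin_numE; last first.
  by apply: integral_ge0 => y _; rewrite lee_fin posterior_pair_ge0.
apply: (@le_lt_trans _ _ (\int[gauss]_y (u a.1 y)%:E)%E); last first.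
  by rewrite integral_sign_likelihood ltry.
apply: ge0_le_integral_nonmeasurable => y; rewrite lee_fin.
- exact: posterior_pair_ge0.
- exact: posterior_pair_le.
Qed.

Lemma sign_coupling_ge0 a : 0 <= sign_coupling a.
Proof.
rewrite -lee_fin -integral_posterior_pair; apply: integral_ge0 => y _.
by rewrite lee_fin posterior_pair_ge0.
Qed.

Lemma sign_couplingC : sign_coupling (false, true) = sign_coupling (true, false).
Proof. by congr fine; apply: eq_integral => y _; rewrite /v/= (mulrC (u _ _)). Qed.

Lemma sum_posterior_pair y : \sum_a v a y = sign_evidence y.
Proof.
rewrite (eq_bigr (fun a => v (a.1, a.2) y)); last by case.
rewrite -(pair_bigA _ (fun a b => v (a, b) y))/= !big_bool/= ?big_bool/= /v/=.
rewrite /sign_evidence; field.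
exact: lt0r_neq0 (sign_evidence_gt0 y).
Qed.

Lemma integral_sign_evidence : (\int[gauss]_y (sign_evidence y)%:E = 1)%E.
Proof.
under eq_integral do rewrite EFinD.
rewrite ge0_integralD//=.
- by rewrite !integral_sign_likelihood -EFinD; congr (_%:E); field.
- by move=> y _; rewrite lee_fin ltW// sign_likelihood_gt0.
- by apply/measurable_EFinP; exact: measurable_sign_likelihood.
- by move=> y _; rewrite lee_fin ltW// sign_likelihood_gt0.
- by apply/measurable_EFinP; exact: measurable_sign_likelihood.
Qed.

Lemma sign_coupling_sum : \sum_a sign_coupling a = 1.
Proof.
apply: EFin_inj; rewrite -sumEFin -integral_sign_evidence.
under eq_bigr do rewrite -integral_posterior_pair.
rewrite -ge0_integral_sum//.
- by apply: eq_integral => y _; rewrite sumEFin sum_posterior_pair.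
- by move=> a; apply/measurable_EFinP; exact: measurable_posterior_pair.
- by move=> a y _; rewrite lee_fin posterior_pair_ge0.
Qed.

(** The product of the two likelihoods is the constant q = exp(-1)/4, so that
    the integrand is q / S with S the evidence, and q / S + q S >= 2 q where S
    has integral 1. *)
Lemma sign_coupling_gt0 : 0 < sign_coupling (true, false).
Proof.
pose q : R := expR (-1) / 4.
have q0 : 0 < q by rewrite divr_gt0// expR_gt0.
suff : 2 * q <= sign_coupling (true, false) + q by lra.
rewrite -lee_fin EFinD -integral_posterior_pair.
rewrite -[X in (_ <= _ + X)%E]mule1 -integral_sign_evidence.
rewrite -ge0_integralZl//; last 3 first.
- by apply/measurable_EFinP; apply: measurable_funD; exact: measurable_sign_likelihood.
- by move=> y _; rewrite lee_fin ltW// sign_evidence_gt0.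
- by rewrite lee_fin ltW.
rewrite -ge0_integralD//; last 4 first.
- by move=> y _; rewrite lee_fin posterior_pair_ge0.
- by apply/measurable_EFinP; exact: measurable_posterior_pair.
- by move=> y _; rewrite -EFinM lee_fin mulr_ge0 ?(ltW q0)// ltW// sign_evidence_gt0.
- apply/measurable_EFinP; apply: measurable_funM => //.
  by apply: measurable_funD; exact: measurable_sign_likelihood.
have -> : ((2 * q)%:E = \int[gauss]_y (2 * q)%:E)%E.
  by rewrite integral_cst//= probability_setT mule1.
apply: ge0_le_integral_nonmeasurable => y; first by rewrite lee_fin mulr_ge0 ?(ltW q0).
rewrite -EFinM -EFinD lee_fin.
have S0 := sign_evidence_gt0 y.
have uu : u true y * u false y = q.
  by rewrite /u/q mulrACA -expRD expr1 expr0; congr (expR _ * _); field.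
rewrite /v/= uu; move: (sign_evidence y) S0 => S S0.
rewrite -subr_ge0 (_ : _ - _ = q * (S - 1) ^+ 2 / S).
  by rewrite divr_ge0 ?(ltW S0)// mulr_ge0 ?(ltW q0)// sqr_ge0.
by field; exact: lt0r_neq0.
Qed.

Lemma sign_coupling_le : sign_coupling (true, false) <= 1 / 2.
Proof.
have := sign_coupling_sum.
rewrite (eq_bigr (fun a => sign_coupling (a.1, a.2))); last by case.
rewrite -(pair_bigA _ (fun a b => sign_coupling (a, b)))/= !big_bool/= ?big_bool/=.
have := sign_coupling_ge0 (true, true); have := sign_coupling_ge0 (false, false).
rewrite sign_couplingC; lra.
Qed.

End posterior.

(** * The lower bound *)

Section bayes_pairs.
Context (R : realType).

(** [x e] is the loss when [e] is the truth, [w / W] the posterior and [dist]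
    the distance of two candidates.  Since dist^2 <= 2 (x e)^2 + 2 (x e')^2, the
    posterior loss of any estimate is at least a quarter of the mean squared
    distance of two posterior draws. *)
Lemma sum_pairs_le (J : finType) (w x : J -> R) (dist : J -> J -> R) :
    (forall e, 0 <= w e) -> 0 < \sum_e w e ->
    (forall e e', 0 <= dist e e' <= x e + x e') ->
  (\sum_e \sum_e' w e * w e' / (\sum_e'' w e'') * dist e e' ^+ 2) / 4
  <= \sum_e w e * x e ^+ 2.
Proof.
move=> w0; set W := \sum_e w e => W0 dx.
apply: (@le_trans _ _ ((\sum_e \sum_e' w e * w e' / W *
    (2 * x e ^+ 2 + 2 * x e' ^+ 2)) / 4)).
  rewrite ler_pM2r ?invr_gt0//; apply: ler_sum => e _; apply: ler_sum => e' _.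
  rewrite ler_wpM2l ?mulr_ge0 ?invr_ge0 ?(ltW W0)//.
  have /andP[d0 dxx] := dx e e'.
  apply: (@le_trans _ _ ((x e + x e') ^+ 2)).
    by rewrite ler_pXn2r ?nnegrE// (le_trans d0).
  have := sqr_ge0 (x e - x e'); nra.
rewrite le_eqVlt; apply/orP; left; apply/eqP.
transitivity ((\sum_e w e * (2 * x e ^+ 2) + \sum_e w e * (2 * x e ^+ 2)) / 4).
  congr (_ / _).
  transitivity (\sum_e \sum_e' (w e' / W * (w e * (2 * x e ^+ 2)) +
      w e / W * (w e' * (2 * x e' ^+ 2)))).
    by apply: eq_bigr => e _; apply: eq_bigr => e' _; field; exact: lt0r_neq0.
  under eq_bigr do rewrite big_split/=.
  rewrite big_split/=; congr (_ + _).
    apply: eq_bigr => e _; rewrite -mulr_suml -mulr_suml divff ?mul1r//.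
    exact: lt0r_neq0.
  under eq_bigr do rewrite -mulr_sumr.
  rewrite -mulr_suml -mulr_suml divff ?mul1r//; exact: lt0r_neq0.
rewrite -mulr2n -[X in X / _]mulr_natr mulr_suml mulr_suml.
by apply: eq_bigr => e _; field.
Qed.

Lemma sum_pair_ffun (I A : finType) (G : (I -> A) -> (I -> A) -> R) :
    (forall a a' b b', a =1 a' -> b =1 b' -> G a b = G a' b') ->
  \sum_(e : {ffun I -> A}) \sum_(e' : {ffun I -> A}) G e e' =
  \sum_(phi : {ffun I -> A * A}) G (fun p => (phi p).1) (fun p => (phi p).2).
Proof.
move=> Gext; rewrite pair_big/=.
pose h (phi : {ffun I -> A * A}) : {ffun I -> A} * {ffun I -> A} :=
  ([ffun p => (phi p).1], [ffun p => (phi p).2]).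
rewrite (reindex h)/=.
  by apply: eq_bigr => phi _; apply: Gext => p; rewrite ffunE.
exists (fun ee : {ffun I -> A} * {ffun I -> A} =>
  [ffun p => (ee.1 p, ee.2 p)]) => [phi _|[e e'] _].
  by apply/ffunP => p; rewrite !ffunE; case: (phi p).
by congr (_, _); apply/ffunP => p; rewrite !ffunE.
Qed.

End bayes_pairs.

Section dual_seminorm.
Context (R : realType) (k s : nat) (J : finType) (B : J -> 'M[R]_(k, s)).
Local Notation mat := (borel_matrix R k s).
Implicit Types A : 'M[R]_(k, s).

(** When the [B b] are contractions, a measurable lower bound of the nuclear
    norm. *)
Definition dual_seminorm A : R := \big[Num.max/0]_b `|\tr (A *m (B b)^T)|.

Lemma dual_seminorm_ge0 A : 0 <= dual_seminorm A.
Proof. exact: bigmax_ge_id. Qed.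

Lemma le_dual_seminorm b A : `|\tr (A *m (B b)^T)| <= dual_seminorm A.
Proof. exact: le_bigmax. Qed.

Lemma dual_seminorm_triangle A A' :
  dual_seminorm (A - A') <= dual_seminorm A + dual_seminorm A'.
Proof.
apply: bigmax_le => [|b _]; first by rewrite addr_ge0// dual_seminorm_ge0.
rewrite mulmxBl linearB/= (le_trans (ler_normB _ _))// lerD//; exact: le_dual_seminorm.
Qed.

Lemma measurable_dual_seminorm d (T : measurableType d) (f : T -> 'M[R]_(k, s)) :
  measurable_fun setT (f : T -> mat) ->
  measurable_fun setT (fun w => dual_seminorm (f w)).
Proof.
move=> mf; rewrite /dual_seminorm; elim: (index_enum J) => [|b bs IH].
  by under eq_fun do rewrite big_nil; exact: measurable_cst.
under eq_fun do rewrite big_cons.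
apply: measurable_maxr => //; apply: measurableT_comp => //.
rewrite /mxtrace; under eq_fun do under eq_bigr do rewrite mulmx_trE.
apply: measurable_sum => i; apply: measurable_sum => j.
apply: measurable_funM => //.
exact: (measurableT_comp (measurable_entry _ _) mf).
Qed.

Lemma dual_seminorm_le_ui_norm (tau : 'rV[R]_(minn k s) -> R) A :
    symmetric_gauge tau ->
    (forall b (u : 'rV[R]_s), sqnorm (u *m (B b)^T) <= sqnorm u) ->
  tau (const_mx 1) * dual_seminorm A <= (minn k s)%:R * ui_norm tau A.
Proof.
move=> gtau B1; have tau0 := gauge_ge0 gtau.
rewrite /dual_seminorm; elim/big_ind : _ => [|x y hx hy|b _].
- by rewrite mulr0 mulr_ge0// tau0.
- by rewrite maxr_pMr// ge_max hx.
- exact: ui_norm_ge.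
Qed.

End dual_seminorm.

Section lower_bound.
Context d (T : measurableType d) (R : realType) (P : probability T R).
Context (k s : nat) (Z : 'I_k * 'I_s -> {RV P >-> R}).
Hypotheses (k0 : (0 < k)%N) (s0 : (0 < s)%N).
Hypothesis iidZ : iid_standard_normal Z.
Variable tau : 'rV[R]_(minn k s) -> R.
Hypothesis gtau : symmetric_gauge tau.
Local Notation mat := (borel_matrix R k s).
Local Notation I := ('I_k * 'I_s)%type.
Local Notation kappa := (@sign_coupling R).
Local Notation sigma := (sign_matrix R (k := k) (s := s)).

Let r : R := kappa (true, false).
Let n := maxn k s.
Let m := minn k s.
Let t : R := 2 / r * Num.sqrt n%:R.
Let B (phi : {ffun I -> bool * bool}) : 'M[R]_(k, s) :=
  dual_certificate (t^-1 *: sign_difference R phi).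
Let N := dual_seminorm B.

Let r0 : 0 < r. Proof. exact: sign_coupling_gt0. Qed.
Let n0 : (0 : R) < n%:R. Proof. by rewrite ltr0n leq_max k0. Qed.
Let m0 : (0 : R) < m%:R. Proof. by rewrite ltr0n leq_min k0. Qed.
Let sqn0 : 0 < Num.sqrt n%:R :> R. Proof. by rewrite sqrtr_gt0. Qed.
Let t0 : 0 < t. Proof. by rewrite mulr_gt0 ?divr_gt0. Qed.

(** The scale [t] = (2/r) sqrt n balances the two terms of the moment bound:
    with r <= 1/2 the negative one is at most half of the positive one. *)
Let expected_seminorm :
  4 * r ^+ 2 * (m%:R * Num.sqrt n%:R) <=
  \sum_phi pair_weight kappa phi * N (sign_difference R phi).
Proof.
have := @expected_dual_gap R k s kappa r (@sign_coupling_ge0 R)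
  (sign_coupling_sum R) (erefl r) (sign_couplingC R) t t0.
move=> gap; apply: le_trans (le_trans gap _); last first.
  apply: ler_sum => phi _.
  by rewrite ler_wpM2l ?pair_weight_ge0//; [exact: sign_coupling_ge0|
    exact: (le_dual_seminorm B)].
have ksE : (k * s)%N = (m * n)%N by rewrite /m /n; case: leqP => _ //; rewrite mulnC.
rewrite ksE !natrM.
have sqrn : n%:R = Num.sqrt n%:R ^+ 2 :> R by rewrite sqr_sqrtr// ltW.
have r12 : r <= 1 / 2 by exact: sign_coupling_le.
rewrite -/n /t; move: (Num.sqrt n%:R) sqn0 sqrn => q q0 ->.
set lhs := 4 * _ * _; set rhs := 2 * _ * _.
have -> : rhs = lhs + 4 * r ^+ 2 * (1 - 2 * r) * (m%:R * q).
  by rewrite /lhs /rhs; field; rewrite !lt0r_neq0.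
rewrite lerDl !mulr_ge0 ?(ltW q0) ?(ltW m0) ?(ltW r0)//; lra.
Qed.

Let expected_seminorm_sqr : (4 * r ^+ 2 * (m%:R * Num.sqrt n%:R)) ^+ 2 <=
  \sum_phi pair_weight kappa phi * N (sign_difference R phi) ^+ 2.
Proof.
set b := 4 * _ * _; have := expected_seminorm; rewrite -/b => bN.
have b0 : 0 <= b by rewrite !mulr_ge0 ?(ltW r0) ?(ltW sqn0) ?(ltW m0).
have W1 := pair_weight_sum k s (sign_coupling_sum R).
apply: (@le_trans _ _ (\sum_phi pair_weight kappa phi *
    (2 * b * N (sign_difference R phi) - b ^+ 2))); last first.
  apply: ler_sum => phi _; rewrite ler_wpM2l ?pair_weight_ge0//.
    exact: sign_coupling_ge0.
  have := sqr_ge0 (N (sign_difference R phi) - b); nra.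
under eq_bigr do rewrite mulrBr mulrCA.
rewrite sumrB -mulr_sumr -mulr_suml W1; nra.
Qed.

Let likelihood_signs (e : I -> bool) (Y : 'M[R]_(k, s)) :
  (\prod_(p : I) 2^-1) * likelihood_ratio (sigma e) Y =
  \prod_p sign_likelihood (e p) (Y p.1 p.2).
Proof.
rewrite /likelihood_ratio -big_split/=; apply: eq_bigr => -[i j] _.
by rewrite !mxE /sign_likelihood mulrC.
Qed.

Let evidence_prod (Y : 'M[R]_(k, s)) :
  \sum_(e : {ffun I -> bool}) \prod_p sign_likelihood (e p) (Y p.1 p.2) =
  \prod_p sign_evidence (Y p.1 p.2).
Proof.
rewrite -(bigA_distr_bigA (fun p b => sign_likelihood b (Y p.1 p.2))).
by apply: eq_bigr => p _; rewrite big_bool.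
Qed.

(** The pointwise Bayes step.  The posterior given [Y] is a product over the
    entries, whose normalizing constant is the product of the evidences. *)
Let average_loss (Y F : 'M[R]_(k, s)) :
  (\sum_(phi : {ffun I -> bool * bool})
     \prod_p posterior_pair (phi p) (Y p.1 p.2) *
     N (sign_difference R phi) ^+ 2) / 4 <=
  \sum_(e : {ffun I -> bool})
     \prod_p sign_likelihood (e p) (Y p.1 p.2) * N (F - sigma e) ^+ 2.
Proof.
pose w (e : {ffun I -> bool}) := \prod_p sign_likelihood (e p) (Y p.1 p.2).
have w0 e : 0 <= w e.
  by apply: prodr_ge0 => p _; rewrite ltW// sign_likelihood_gt0.
have W0 : 0 < \sum_e w e.
  by rewrite evidence_prod; apply: prodr_gt0 => p _; exact: sign_evidence_gt0.
have dx (e e' : {ffun I -> bool}) :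
    0 <= N (sigma e - sigma e') <= N (F - sigma e) + N (F - sigma e').
  rewrite dual_seminorm_ge0/= [leRHS]addrC.
  have -> : sigma e - sigma e' = (F - sigma e') - (F - sigma e).
    by rewrite opprB [RHS]addrC addrA subrK.
  exact: dual_seminorm_triangle.
apply: le_trans (sum_pairs_le w0 W0 dx).
rewrite ler_pM2r ?invr_gt0// le_eqVlt; apply/orP; left; apply/eqP/esym.
pose G (a b : I -> bool) := (\prod_p sign_likelihood (a p) (Y p.1 p.2)) *
  (\prod_p sign_likelihood (b p) (Y p.1 p.2)) /
  (\prod_p sign_evidence (Y p.1 p.2)) * N (sigma a - sigma b) ^+ 2.
transitivity (\sum_(e : {ffun I -> bool}) \sum_(e' : {ffun I -> bool}) G e e').
  by apply: eq_bigr => e _; apply: eq_bigr => e' _; rewrite /G evidence_prod.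
rewrite sum_pair_ffun; last first.
  move=> a a' b b' aa bb; rewrite /G; congr (_ * _ / _ * N _ ^+ 2).
  - by apply: eq_bigr => p _; rewrite aa.
  - by apply: eq_bigr => p _; rewrite bb.
  - by apply/matrixP => i j; rewrite !mxE aa bb.
apply: eq_bigr => phi _; rewrite /G /sign_difference; congr (_ * _).
by rewrite -big_split/= -prodfV -big_split.
Qed.

(** The supremum over [M] is at least the average over the [2 ^ (k s)] sign
    matrices; the change of measure moves all these risks under one integral,
    where the pointwise bound applies. *)
Lemma minimax_lower_bound :
  ((4 * r ^+ 4 * (maxn k s)%:R * tau (const_mx 1) ^+ 2)%:E
   <= minimax_risk Z tau)%E.
Proof.
apply: le_ereal_inf_tmp => _ [f mf <-].
set S := ereal_sup _.
pose c0 := tau (const_mx 1) / m%:R.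
have c00 : 0 <= c0 by rewrite divr_ge0 ?gauge_ge0// ltW.
pose h e (Y : 'M[R]_(k, s)) := (c0 * N (f Y - sigma e)) ^+ 2.
have h0 e Y : 0 <= h e Y by exact: sqr_ge0.
have mh e : measurable_fun setT (h e : mat -> R).
  apply: measurable_funX; apply: measurable_funM => //.
  apply: (@measurable_dual_seminorm _ _ _ _ _ _ mat).
  apply: measurable_into_matrix => i j.
  under eq_fun do rewrite !mxE; apply: measurable_funB => //.
  exact: (measurableT_comp (measurable_entry _ _) mf).
have mNoise : measurable_fun setT (noise_matrix Z : T -> mat).
  have := measurable_noise Z 0; congr measurable_fun; apply/funext => w.
  exact: add0r.
pose LR e w := likelihood_ratio (sigma e) (noise_matrix Z w).
have step e : (\int[P]_w (h e (noise_matrix Z w) * LR e w)%:E <= S)%E.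
  apply: (@le_trans _ _ (risk Z tau f (sigma e))); last first.
    by apply: ereal_sup_ubound; exists (sigma e).
  rewrite -gaussian_change_of_measure// /risk unlock.
  apply: ge0_le_integral_nonmeasurable => w; rewrite lee_fin//.
  set A := f _ - _; have := dual_seminorm_le_ui_norm A gtau
    (fun phi => dual_certificate_contraction (t^-1 *: sign_difference R phi)).
  rewrite -/N => NA.
  have cN : c0 * N A <= ui_norm tau A by rewrite mulrAC ler_pdivrMr// [leRHS]mulrC.
  have cN0 : 0 <= c0 * N A by rewrite mulr_ge0// dual_seminorm_ge0.
  by rewrite ler_pXn2r// nnegrE// (le_trans cN0).
(* The prior mass 2^-(k s) of one sign matrix, as a product over the entries. *)
pose half := \prod_(p : I) (2^-1 : R).
have half0 : 0 <= half by apply: prodr_ge0 => p _; rewrite invr_ge0.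
have S0 : (0 <= S)%E.
  apply: le_trans (step (fun=> true)); apply: integral_ge0 => w _.
  rewrite lee_fin mulr_ge0// /LR; apply: prodr_ge0 => p _; exact: expR_ge0.
have -> : S = (\sum_(e : {ffun I -> bool}) half%:E * S)%E.
  rewrite -ge0_sume_distrl => [|e _]; last by rewrite lee_fin.
  rewrite sumEFin.
  have -> : \sum_(e : {ffun I -> bool}) half = 1.
    transitivity (\prod_(p : I) \sum_(b : bool) (2^-1 : R)).
      by rewrite bigA_distr_bigA.
    by rewrite big1// => p _; rewrite big_bool/=; field.
  by rewrite mul1e.
have mLR e : measurable_fun setT (LR e).
  exact: measurable_likelihood_ratio.
have LR0 e w : 0 <= LR e w by apply: prodr_ge0 => p _; exact: expR_ge0.
have mhLR e : measurable_fun setT (fun w => h e (noise_matrix Z w) * LR e w).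
  by apply: measurable_funM => //; exact: (measurableT_comp (mh e)).
pose V phi w := \prod_p posterior_pair (phi p) (Z p w).
have mv phi : measurable_fun setT (V phi).
  apply: measurable_prod => p _.
  exact: (measurableT_comp (measurable_posterior_pair _)).
have V0 phi w : 0 <= V phi w by apply: prodr_ge0 => p _; exact: posterior_pair_ge0.
pose C phi := c0 ^+ 2 * N (sign_difference R phi) ^+ 2 / 4.
have C0 phi : 0 <= C phi.
  by rewrite divr_ge0// mulr_ge0// sqr_ge0.
apply: (@le_trans _ _ (\int[P]_w (\sum_phi C phi * V phi w)%:E)%E).
  under eq_integral do rewrite -sumEFin.
  rewrite ge0_integral_sum//; last 2 first.
  - by move=> phi; apply/measurable_EFinP; exact: measurable_funM.
  - by move=> phi w _; rewrite lee_fin mulr_ge0.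
  have intV phi : (\int[P]_w (C phi * V phi w)%:E =
      (C phi * pair_weight kappa phi)%:E)%E.
    under eq_integral do rewrite EFinM.
    rewrite ge0_integralZl//; last 3 first.
    - exact/measurable_EFinP.
    - by move=> w _; rewrite lee_fin.
    - by rewrite lee_fin.
    rewrite (iid_integral_prod iidZ (g := fun p => posterior_pair (phi p))
      (a := fun p => kappa (phi p)))//.
    - by move=> p; exact: measurable_posterior_pair.
    - by move=> p y; exact: posterior_pair_ge0.
    - by move=> p; exact: integral_posterior_pair.
  under eq_bigr do rewrite intV.
  rewrite sumEFin lee_fin.
  have -> : \sum_phi C phi * pair_weight kappa phi = c0 ^+ 2 / 4 *
      \sum_phi pair_weight kappa phi * N (sign_difference R phi) ^+ 2.
    by rewrite mulr_sumr; apply: eq_bigr => phi _; rewrite /C; ring.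
  apply: le_trans (ler_wpM2l _ expected_seminorm_sqr); last first.
    by rewrite divr_ge0 ?sqr_ge0.
  rewrite le_eqVlt; apply/orP; left; apply/eqP.
  have sqrn : n%:R = Num.sqrt n%:R ^+ 2 :> R by rewrite sqr_sqrtr// ltW.
  rewrite -/n {1}sqrn /c0; field; exact: lt0r_neq0.
apply: (@le_trans _ _ (\sum_(e : {ffun I -> bool})
    half%:E * \int[P]_w (h e (noise_matrix Z w) * LR e w)%:E)%E); last first.
  by apply: lee_sum => e _; apply: lee_wpmul2l => //; rewrite lee_fin.
have inner e : (half%:E * \int[P]_w (h e (noise_matrix Z w) * LR e w)%:E =
    \int[P]_w (half * (h e (noise_matrix Z w) * LR e w))%:E)%E.
  under [RHS]eq_integral do rewrite EFinM.
  rewrite ge0_integralZl//.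
  - exact/measurable_EFinP.
  - by move=> w _; exact: (mulr_ge0 (h0 _ _) (LR0 _ _)).
under eq_bigr do rewrite inner.
rewrite -ge0_integral_sum//; last 2 first.
- by move=> e; apply/measurable_EFinP; apply: measurable_funM.
- by move=> e w _; exact: (mulr_ge0 half0 (mulr_ge0 (h0 _ _) (LR0 _ _))).
apply: ge0_le_integral_nonmeasurable => w.
  by rewrite lee_fin; apply: sumr_ge0 => phi _; rewrite mulr_ge0.
rewrite sumEFin lee_fin.
have := average_loss (noise_matrix Z w) (f (noise_matrix Z w)).
move=> /(ler_wpM2l (sqr_ge0 c0)).
congr (_ <= _).
  rewrite mulrA mulr_sumr mulr_suml; apply: eq_bigr => phi _.
  rewrite /C /V; have -> : \prod_p posterior_pair (phi p) (noise_matrix Z w p.1 p.2)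
    = \prod_p posterior_pair (phi p) (Z p w).
    by apply: eq_bigr => -[i j] _; rewrite mxE.
  ring.
rewrite mulr_sumr; apply: eq_bigr => e _.
rewrite -likelihood_signs /h /LR -/half [(c0 * _) ^+ 2]exprMn.
by rewrite mulrCA -mulrA [X in half * X]mulrC.
Qed.

End lower_bound.

(** * Nets made of lattice points *)

Section lattice_net.
Context (R : realType).

(** Integer points, stored as sign and magnitude.  A magnitude bounded by 16 n
    is no restriction for points whose squares sum to at most 16 n. *)
Definition lattice n := {ffun 'I_n -> bool * 'I_(16 * n).+1}.

Definition lattice_vec n (a : lattice n) : 'rV[R]_n :=
  \row_i ((-1) ^+ (a i).1 * ((a i).2)%:R / (4 * Num.sqrt n%:R)).

Definition in_net n (a : lattice n) : bool := (\sum_i (a i).2 ^ 2 <= 16 * n)%N.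

Lemma sqnormZ n c (u : 'rV[R]_n) : sqnorm (c *: u) = c ^+ 2 * sqnorm u.
Proof. by rewrite /sqnorm mulr_sumr; apply: eq_bigr => j _; rewrite mxE exprMn. Qed.

Lemma sqnorm_lattice_vec n (a : lattice n) : (0 < n)%N -> in_net a ->
  sqnorm (lattice_vec a) <= 1.
Proof.
move=> n0 na; have n0R : (0 : R) < n%:R by rewrite ltr0n.
rewrite /sqnorm (eq_bigr (fun i => ((a i).2 ^ 2)%:R / (16 * n%:R))); last first.
  move=> i _; rewrite mxE expr_div_n exprMn sqrr_sign mul1r exprMn sqr_sqrtr ?(ltW n0R)//.
  by rewrite natrX; congr (_ / (_ * _)); ring.
rewrite -mulr_suml -natr_sum ler_pdivrMr ?mulr_gt0// mul1r.
by rewrite -natrM ler_nat.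
Qed.

(** Rounding the magnitude of [4 sqrt n x] downwards keeps the point in the unit
    ball and moves each coordinate of [x] by at most 1 / (4 sqrt n), that is
    [x] by at most 1/4. *)
Lemma lattice_approx n (x : 'rV[R]_n) : (0 < n)%N -> sqnorm x <= 1 ->
  exists2 a : lattice n, in_net a & sqnorm (4 *: (x - lattice_vec a)) <= 1.
Proof.
move=> n0 x1; have n0R : (0 : R) < n%:R by rewrite ltr0n.
pose q : R := Num.sqrt n%:R; have q0 : 0 < q by rewrite sqrtr_gt0.
have qq : q ^+ 2 = n%:R by rewrite sqr_sqrtr// ltW.
pose y i := 4 * q * `|x 0 i|.
have y0 i : 0 <= y i by rewrite !mulr_ge0// ltW.
pose t i := Num.truncn (y i).
have ty i : (t i)%:R <= y i by rewrite truncn_le.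
have yt i : y i < (t i)%:R + 1 by rewrite natr1 truncnS_gt.
have sumt : (\sum_i (t i) ^ 2 <= 16 * n)%N.
  rewrite -(ler_nat R) natr_sum natrM -qq.
  apply: (@le_trans _ _ (\sum_i y i ^+ 2)).
    by apply: ler_sum => i _; rewrite natrX ler_pXn2r ?nnegrE.
  under eq_bigr do rewrite exprMn real_normK ?num_real//.
  rewrite -mulr_sumr -[leRHS]mulr1 (_ : 16 * _ = (4 * q) ^+ 2); last by ring.
  by rewrite ler_wpM2l ?sqr_ge0.
have tb i : (t i < (16 * n).+1)%N.
  rewrite ltnS; apply: leq_trans sumt; rewrite (bigD1 i)//=.
  by apply: leq_trans (leq_addr _ _); case: (t i) => // m; rewrite -mulnn leq_pmulr.
exists [ffun i => (x 0 i < 0, Ordinal (tb i))].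
  rewrite /in_net; apply: leq_trans sumt.
  by apply: leq_sum => i _; rewrite ffunE.
rewrite sqnormZ.
apply: (@le_trans _ _ (4 ^+ 2 * (\sum_(i < n) (4 * q) ^- 2))); last first.
  rewrite sumr_const card_ord -[X in _ * X]mulr_natr -qq.
  rewrite le_eqVlt; apply/orP; left; apply/eqP.
  by field; exact: lt0r_neq0.
rewrite ler_wpM2l ?sqr_ge0//; apply: ler_sum => i _; rewrite !mxE ffunE/=.
have xE : x 0 i = (-1) ^+ (x 0 i < 0)%R * (y i / (4 * q)).
  rewrite {1}[x 0 i]numEsign /y; congr (_ * _).
  by rewrite [_ / _]mulrAC mulfV ?mul1r// mulf_neq0// lt0r_neq0.
rewrite [X in X - _]xE -/q -[X in _ - X]mulrA -mulrBr exprMn sqrr_sign mul1r.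
rewrite -mulrBl exprMn exprVn ler_piMl ?invr_ge0 ?sqr_ge0//.
rewrite expr_le1// ?subr_ge0 ?ty// lerBlDr addrC ltW//; exact: yt.
Qed.

(** The indicator of the net is at most exp(16 n - |a|^2), which factors over the
    coordinates; each factor is at most exp(16), times 2 for the signs, times
    the sum of exp(- i^2) <= 2^-i, and 4 exp(16) <= exp(18). *)
Lemma net_size n : (\sum_(a : lattice n | in_net a) 1 <= expR 18 ^+ n :> R).
Proof.
pose g (c : bool * 'I_(16 * n).+1) : R := expR 16 * expR (- (c.2)%:R ^+ 2).
have g0 c : 0 <= g c by rewrite mulr_ge0 ?expR_ge0.
apply: (@le_trans _ _ (\sum_(a : lattice n) \prod_i g (a i))).
  rewrite [leLHS]big_mkcond/=; apply: ler_sum => a _; case: ifP => na; last first.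
    exact: prodr_ge0.
  rewrite big_split/= prodr_const card_ord -expRM_natl -expR_sum -expRD.
  rewrite -[leLHS]expR0 ler_expR sumrN subr_ge0 mulr_natl.
  under eq_bigr do rewrite -natrX.
  by rewrite -natr_sum (_ : 16 *+ n = (16 * n)%:R) ?ler_nat// natrM mulr_natr.
rewrite -(bigA_distr_bigA (fun=> g)) prodr_const card_ord.
rewrite lerXn2r ?nnegrE ?sumr_ge0 ?expR_ge0//.
rewrite -(pair_bigA _ (fun b c => g (b, c)))/= big_bool/= /g/= -mulr_sumr.
have e2 : 2 <= expR 1 :> R by have := expR_ge1Dx (1 : R); lra.
have : \sum_(i < (16 * n).+1) expR (- i%:R ^+ 2) <= 2 :> R.
  apply: (@le_trans _ _ (\sum_(i < (16 * n).+1) (2^-1) ^+ i)).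
    apply: ler_sum => i _.
    apply: (@le_trans _ _ (expR (- i%:R))).
      rewrite ler_expR lerN2; case: (nat_of_ord i) => [|m]; first by rewrite expr0n.
      by rewrite expr2 ler_pMl ?ltr0n// ler1n.
    rewrite expRN -[i%:R]mulr1 expRM_natl -exprVn lerXn2r ?nnegrE ?invr_ge0 ?expR_ge0//.
    by rewrite lef_pV2 ?posrE ?expR_gt0.
  have pow0 : 0 <= (2^-1 : R) ^+ (16 * n).+1 by rewrite exprn_ge0// invr_ge0.
  have neg : 2^-1 - 1 < 0 :> R by lra.
  rewrite -(ler_nM2l neg) -subrX1; lra.
have -> : expR 18 = expR 16 * (expR 1 * expR 1) :> R.
  by rewrite -!expRD; congr expR; ring.
move=> S2; rewrite -mulrDr ler_pM2l ?expR_gt0//.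
apply: le_trans (lerD S2 S2) _.
have := ler_pM (ler0n R 2) (ler0n R 2) e2 e2; lra.
Qed.

End lattice_net.

(** * The upper bound *)

Section operator_norm.
Context (R : realType) (k s : nat) (A : 'M[R]_(k, s)).

Definition mxform (u : 'rV[R]_k) (v : 'rV[R]_s) : R := (u *m A *m v^T) 0 0.

Lemma mxformE u v : mxform u v = \sum_i \sum_j u 0 i * v 0 j * A i j.
Proof.
rewrite /mxform mulmx_trE exchange_big/=; apply: eq_bigr => j _.
by rewrite mxE mulr_suml; apply: eq_bigr => i _; rewrite mulrAC.
Qed.

Let mxformBl u u' v : mxform (u - u') v = mxform u v - mxform u' v.
Proof. by rewrite /mxform !mulmxBl !mxE. Qed.
Let mxformBr u v v' : mxform u (v - v') = mxform u v - mxform u v'.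
Proof. by rewrite /mxform linearB/= mulmxBr !mxE. Qed.
Let mxformZl c u v : mxform (c *: u) v = c * mxform u v.
Proof. by rewrite /mxform -!scalemxAl !mxE. Qed.
Let mxformZr c u v : mxform u (c *: v) = c * mxform u v.
Proof. by rewrite /mxform linearZ/= -scalemxAr !mxE. Qed.

Let sqnorm_le1 n (u : 'rV[R]_n) i : sqnorm u <= 1 -> `|u 0 i| <= 1.
Proof.
move=> u1; rewrite -(@ler_pXn2r _ 2)// ?nnegrE// expr1n real_normK ?num_real//.
apply: le_trans u1; rewrite /sqnorm (bigD1 i)//= lerDl.
by apply: sumr_ge0 => j _; exact: sqr_ge0.
Qed.

Let sqnorm_eq0 n (u : 'rV[R]_n) : sqnorm u = 0 -> u = 0.
Proof.
move=> /psumr_eq0P u0; apply/rowP => i; rewrite mxE; apply/eqP.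
by rewrite -sqrf_eq0 u0// => j _; exact: sqr_ge0.
Qed.

Let sqnorm0 n : sqnorm (0 : 'rV[R]_n) = 0.
Proof. by apply: big1 => i _; rewrite mxE expr0n. Qed.

(** If L is the supremum of the form over the two unit balls, replacing both
    arguments by net points at distance 1/4 costs at most L/4 twice, so
    L <= m + L/2. *)
Lemma net_operator_bound m : (0 < k)%N -> (0 < s)%N -> 0 <= m ->
    (forall (a : lattice k) (b : lattice s), in_net a -> in_net b ->
      mxform (lattice_vec R a) (lattice_vec R b) <= m) ->
  forall u : 'rV[R]_s, sqnorm (u *m A^T) <= (2 * m) ^+ 2 * sqnorm u.
Proof.
move=> k0 s0 m0 netm.
pose S := [set x | exists u v, [/\ sqnorm u <= 1, sqnorm v <= 1 & x = mxform u v]].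
have S0 : S 0.
  by exists 0, 0; rewrite !sqnorm0 ler01 /mxform !mul0mx mxE.
have supS : has_sup S.
  split; first by exists 0.
  exists (\sum_i \sum_j `|A i j|) => _ [u [v [u1 v1 ->]]].
  rewrite mxformE; apply: ler_sum => i _; apply: ler_sum => j _.
  apply: le_trans (ler_norm _) _; rewrite !normrM ler_piMl//.
  by rewrite mulr_ile1// sqnorm_le1.
pose L := sup S.
have SL u v : sqnorm u <= 1 -> sqnorm v <= 1 -> mxform u v <= L.
  by move=> u1 v1; apply: (sup_upper_bound supS); exists u, v.
have L0 : 0 <= L by exact: (sup_upper_bound supS).
have L2m : L <= 2 * m.
  suff : L <= m + L / 2 by lra.
  apply: sup_le_ub; first by exists 0.
  move=> _ [u [v [u1 v1 ->]]].
  have [a na ua] := lattice_approx k0 u1; have [b nb vb] := lattice_approx s0 v1.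
  set u' := lattice_vec R a in ua *; set v' := lattice_vec R b in vb *.
  have -> : mxform u v = mxform u' v' + 4^-1 * mxform (4 *: (u - u')) v
      + 4^-1 * mxform u' (4 *: (v - v')).
    by rewrite mxformZl mxformZr mxformBl mxformBr; field.
  have h1 := netm a b na nb; rewrite -/u' -/v' in h1.
  have h2 := SL _ _ ua v1.
  have h3 := SL _ _ (sqnorm_lattice_vec R k0 na) vb; rewrite -/u' in h3.
  lra.
move=> u; set w := u *m A^T.
have ww : mxform w u = sqnorm w.
  rewrite /mxform /w -[A in _ *m A *m _]trmxK -mulmxA -trmx_mul.
  by rewrite mulmx_trE; apply: eq_bigr => j _; rewrite expr2.
apply: (@le_trans _ _ (L ^+ 2 * sqnorm u)); last first.
  by rewrite ler_wpM2r ?sqnorm_ge0// lerXn2r// ?nnegrE// mulr_ge0.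
have [u0|un0] := eqVneq (sqnorm u) 0.
  by rewrite /w (sqnorm_eq0 u0) mul0mx !sqnorm0 mulr0.
have [w0|wn0] := eqVneq (sqnorm w) 0.
  by rewrite w0 mulr_ge0 ?sqr_ge0 ?sqnorm_ge0.
pose p := Num.sqrt (sqnorm w); pose q := Num.sqrt (sqnorm u).
have p0 : 0 < p by rewrite sqrtr_gt0 lt_neqAle eq_sym wn0 sqnorm_ge0.
have q0 : 0 < q by rewrite sqrtr_gt0 lt_neqAle eq_sym un0 sqnorm_ge0.
have pp : sqnorm w = p ^+ 2 by rewrite sqr_sqrtr ?sqnorm_ge0.
have qq : sqnorm u = q ^+ 2 by rewrite sqr_sqrtr ?sqnorm_ge0.
have := SL (p^-1 *: w) (q^-1 *: u).
rewrite !sqnormZ pp qq -!exprMn !mulVf ?lt0r_neq0// expr1n lexx => /(_ isT isT).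
rewrite mxformZl mxformZr ww pp => pqL.
have pLq : p <= L * q.
  rewrite -ler_pdivrMr//; apply: le_trans _ pqL.
  by rewrite le_eqVlt; apply/orP; left; apply/eqP; field; rewrite !lt0r_neq0.
by rewrite lerXn2r// nnegrE ?(ltW p0)// mulr_ge0// ltW.
Qed.

End operator_norm.

Section upper_bound.
Context d (T : measurableType d) (R : realType) (P : probability T R).
Context (k s : nat) (Z : 'I_k * 'I_s -> {RV P >-> R}).
Hypotheses (k0 : (0 < k)%N) (s0 : (0 < s)%N).
Hypothesis iidZ : iid_standard_normal Z.
Variable tau : 'rV[R]_(minn k s) -> R.
Hypothesis gtau : symmetric_gauge tau.
Let n := maxn k s.
Let q : R := Num.sqrt n%:R.
Let nets (ab : lattice k * lattice s) := in_net ab.1 && in_net ab.2.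

Let n0 : (0 : R) < n%:R. Proof. by rewrite ltr0n leq_max k0. Qed.
Let q0 : 0 < q. Proof. by rewrite sqrtr_gt0. Qed.
Let qq : q ^+ 2 = n%:R. Proof. by rewrite sqr_sqrtr// ltW. Qed.

Let X (ab : lattice k * lattice s) (A : 'M[R]_(k, s)) : R :=
  mxform A (lattice_vec R ab.1) (lattice_vec R ab.2).

(** Sum of exponential moments over the net.  The constant 37 dominates
    18 + 18 for the cardinals of the two nets plus 1/2 for the Gaussian moment
    generating function, so that its mean under the noise is at most 1. *)
Let E (A : 'M[R]_(k, s)) : R :=
  \sum_(ab | nets ab) expR (q * X ab A - 37 * n%:R).

Let E_ge0 A : 0 <= E A.
Proof. by apply: sumr_ge0 => ab _; exact: expR_ge0. Qed.

(** Writing the form as sqrt n (37 + D), the term of [E A] at this net point is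
    exp(n D), and D^2 / 4 <= exp(D) <= exp(n D) when D > 0. *)
Let net_form_le A ab : nets ab -> X ab A <= q * (37 + Num.sqrt (4 * E A)).
Proof.
move=> nab.
have q1 : 1 <= q.
  by rewrite -sqrtr1 ler_sqrt ?ler0n// ler1n leq_max k0.
set y := X ab A; pose D := y / q - 37.
have -> : y = q * (37 + D) by rewrite /D; field; exact: lt0r_neq0.
rewrite ler_pM2l// lerD2l.
have [D0|D0] := leP D 0; first by rewrite (le_trans D0)// sqrtr_ge0.
rewrite -(ger0_norm (ltW D0)) -sqrtr_sqr ler_wsqrtr// .
have DE : expR (q * y - 37 * n%:R) <= E A.
  by rewrite /E (bigD1 ab)//= lerDl sumr_ge0// => *; exact: expR_ge0.
have DD : D <= q * y - 37 * n%:R.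
  rewrite -qq (_ : _ - _ = q ^+ 2 * D); last by rewrite /D; field; exact: lt0r_neq0.
  by rewrite ler_peMl ?(ltW D0)// expr_ge1// ltW.
suff : D ^+ 2 / 4 <= expR D.
  move=> h; have : expR D <= E A by apply: le_trans DE; rewrite ler_expR.
  lra.
have h := expR_ge1Dx (D / 2).
have -> : expR D = expR (D / 2) ^+ 2 by rewrite -expRM_natl; congr expR; field.
apply: (@le_trans _ _ ((1 + D / 2) ^+ 2)); last first.
  by rewrite lerXn2r ?nnegrE ?expR_ge0// addr_ge0// divr_ge0// ltW.
nra.
Qed.

Let ui_norm_sqr_le A : ui_norm tau A ^+ 2 <=
  4 * n%:R * (2 * 37 ^+ 2 + 8 * E A) * tau (const_mx 1) ^+ 2.
Proof.
pose m := q * (37 + Num.sqrt (4 * E A)).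
have m0 : 0 <= m by rewrite mulr_ge0 ?(ltW q0)// addr_ge0// sqrtr_ge0.
have := net_operator_bound k0 s0 m0 (fun a b na nb => @net_form_le A (a, b)
  (introT andP (conj na nb))).
move=> /(ui_norm_le gtau (mulr_ge0 (ler0n R 2) m0)) AL.
apply: (@le_trans _ _ ((2 * m * tau (const_mx 1)) ^+ 2)).
  rewrite lerXn2r ?nnegrE// ?gauge_ge0// mulr_ge0 ?gauge_ge0//.
  by rewrite mulr_ge0.
rewrite exprMn ler_wpM2r ?sqr_ge0//.
have -> : (2 * m) ^+ 2 = 4 * n%:R * (37 + Num.sqrt (4 * E A)) ^+ 2.
  by rewrite -qq /m; ring.
rewrite ler_pM2l ?mulr_gt0//.
have e2 : Num.sqrt (4 * E A) ^+ 2 = 4 * E A by rewrite sqr_sqrtr// mulr_ge0.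
have := sqr_ge0 (37 - Num.sqrt (4 * E A)); nra.
Qed.

Let X_sum ab w : X ab (noise_matrix Z w) =
  \sum_p lattice_vec R ab.1 0 p.1 * lattice_vec R ab.2 0 p.2 * Z p w.
Proof.
rewrite /X mxformE pair_bigA/=; by apply: eq_bigr => -[i j] _; congr (_ * _); rewrite mxE.
Qed.

Let expE ab w : expR (q * X ab (noise_matrix Z w) - 37 * n%:R) =
  expR (- (37 * n%:R)) * \prod_p expR
   (q * (lattice_vec R ab.1 0 p.1 * lattice_vec R ab.2 0 p.2) * Z p w).
Proof.
rewrite addrC expRD X_sum mulr_sumr expR_sum; congr (_ * _).
by apply: eq_bigr => p _; rewrite !mulrA.
Qed.

Let mexp (c : R) : measurable_fun setT (fun x : R => expR (c * x)).
Proof. by apply: measurableT_comp => //; exact: measurable_funM. Qed.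

Let integral_exp ab : nets ab ->
  (\int[P]_w (expR (q * X ab (noise_matrix Z w) - 37 * n%:R))%:E <=
   (expR (- (37 * n%:R)) * expR (n%:R / 2))%:E)%E.
Proof.
move=> /andP[na nb].
under eq_integral do rewrite expE EFinM.
rewrite ge0_integralZl//; last 2 first.
- apply/measurable_EFinP; apply: measurable_prod => p _.
  exact: (measurableT_comp (mexp _)).
- by move=> w _; rewrite lee_fin; apply: prodr_ge0 => p _; exact: expR_ge0.
pose z p := lattice_vec R ab.1 0 p.1 * lattice_vec R ab.2 0 p.2.
rewrite (iid_integral_prod iidZ (g := fun p x => expR (q * z p * x))
  (a := fun p => expR ((q * z p) ^+ 2 / 2)))//; last first.
  by move=> p; exact: normal_mgf.
rewrite -EFinM lee_fin ler_pM2l ?expR_gt0// -expR_sum ler_expR -mulr_suml.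
rewrite ler_pM2r ?invr_gt0//.
have -> : \sum_p (q * z p) ^+ 2 =
    n%:R * (sqnorm (lattice_vec R ab.1) * sqnorm (lattice_vec R ab.2)).
  rewrite /sqnorm big_distrlr/= pair_bigA mulr_sumr; apply: eq_bigr => p _.
  by rewrite !exprMn qq.
rewrite ler_piMr ?ler0n// mulr_ile1 ?sqnorm_ge0// sqnorm_lattice_vec//.
Qed.

Let integral_E : (\int[P]_w (E (noise_matrix Z w))%:E <= 1%:E)%E.
Proof.
under eq_integral do rewrite /E -sumEFin.
have mX ab : measurable_fun setT (fun w =>
    (expR (q * X ab (noise_matrix Z w) - 37 * n%:R))%:E).
  apply/measurable_EFinP; under eq_fun do rewrite expE.
  apply: measurable_funM => //; apply: measurable_prod => p _.
  exact: (measurableT_comp (mexp _)).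
under eq_integral do rewrite -big_filter.
rewrite ge0_integral_sum//.
rewrite big_filter.
apply: le_trans (lee_sum _ integral_exp) _.
rewrite sumEFin lee_fin -expRD.
pose c : R := expR (- (37 * n%:R) + n%:R / 2).
have -> : \sum_(ab | nets ab) expR (- (37 * n%:R) + n%:R / 2) =
    (\sum_(a : lattice k | in_net a) 1) * (\sum_(b : lattice s | in_net b) 1) * c.
  rewrite big_distrlr/= pair_big/= mulr_suml.
  by apply: eq_big => [[a b]|[a b] _]//=; rewrite mul1r mul1r.
apply: (@le_trans _ _ (expR 18 ^+ k * expR 18 ^+ s * c)).
  rewrite ler_pM2r ?expR_gt0//.
  by rewrite ler_pM ?net_size ?sumr_ge0.
rewrite -!expRM_natl /c -!expRD -[leRHS]expR0 ler_expR.
have : k%:R <= n%:R :> R by rewrite ler_nat leq_maxl.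
have : s%:R <= n%:R :> R by rewrite ler_nat leq_maxr.
have := ltW n0; lra.
Qed.

Lemma minimax_upper_bound : (minimax_risk Z tau <=
  ((4 * (2 * 37 ^+ 2 + 8)) * (maxn k s)%:R * tau (const_mx 1) ^+ 2)%:E)%E.
Proof.
apply: (@le_trans _ _ (ereal_sup [set risk Z tau id M | M in setT])).
  by apply: ereal_inf_lbound; exists id => //; exact: measurable_id.
apply: ge_ereal_sup => _ [M _ <-]; rewrite /risk unlock.
pose c := 4 * n%:R * tau (const_mx 1) ^+ 2.
have c0 : 0 <= c by rewrite mulr_ge0 ?sqr_ge0// mulr_ge0// ltW.
apply: (@le_trans _ _ (\int[P]_w
    ((c * (2 * 37 ^+ 2))%:E + (c * 8)%:E * (E (noise_matrix Z w))%:E))%E).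
  apply: ge0_le_integral_nonmeasurable => w; first by rewrite lee_fin sqr_ge0.
  rewrite addrC addKr -EFinM -EFinD lee_fin.
  apply: le_trans (ui_norm_sqr_le _) _.
  by rewrite le_eqVlt; apply/orP; left; apply/eqP; rewrite /c; ring.
have mE : measurable_fun setT (fun w => E (noise_matrix Z w)).
  rewrite /E; under eq_fun do rewrite -big_filter.
  apply: measurable_sum => ab; under eq_fun do rewrite expE.
  apply: measurable_funM => //; apply: measurable_prod => p _.
  exact: (measurableT_comp (mexp _)).
have c8 : 0 <= c * 8 by rewrite mulr_ge0.
rewrite ge0_integralD//; last 3 first.
- by move=> w _; rewrite lee_fin mulr_ge0// mulr_ge0// sqr_ge0.
- by move=> w _; rewrite -EFinM lee_fin mulr_ge0.
- by apply/measurable_EFinP; exact: measurable_funM.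
have -> : (\int[P]_w (c * (2 * 37 ^+ 2))%:E = (c * (2 * 37 ^+ 2))%:E)%E.
  by rewrite integral_cst//= probability_setT mule1.
rewrite ge0_integralZl//; last 2 first.
- exact/measurable_EFinP.
- by move=> w _; rewrite lee_fin.
apply: (@le_trans _ _ ((c * (2 * 37 ^+ 2))%:E + (c * 8)%:E * 1%:E)%E).
  by apply: leeD => //; apply: lee_wpmul2l => //; rewrite lee_fin.
rewrite -EFinM -EFinD lee_fin le_eqVlt; apply/orP; left; apply/eqP.
by rewrite /c -/n; ring.
Qed.

End upper_bound.

(** * The minimax rate *)

Theorem theorem3 (R : realType) :
  exists c C : R, [/\ 0 < c, c <= C &
    forall (k s : nat), (0 < k)%N -> (0 < s)%N ->
    forall tau : 'rV[R]_(minn k s) -> R, symmetric_gauge tau ->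
    forall (d : measure_display) (T : measurableType d) (P : probability T R)
      (Z : 'I_k * 'I_s -> {RV P >-> R}), iid_standard_normal Z ->
    ((c * (maxn k s)%:R * tau (const_mx 1) ^+ 2)%:E <= minimax_risk Z tau)%E /\
    (minimax_risk Z tau <= (C * (maxn k s)%:R * tau (const_mx 1) ^+ 2)%:E)%E].
Proof.
exists (4 * sign_coupling R (true, false) ^+ 4), (4 * (2 * 37 ^+ 2 + 8)); split.
- by rewrite mulr_gt0// exprn_gt0// sign_coupling_gt0.
- rewrite ler_pM2l//; apply: (@le_trans _ _ 1); last by lra.
  have := sign_coupling_le R => r12.
  by rewrite exprn_ile1 ?sign_coupling_ge0//; lra.
- move=> k s k0 s0 tau gtau d T P Z iidZ; split.
  + exact: minimax_lower_bound.
  + exact: minimax_upper_bound.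
Qed.
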